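(* Let $\mathcal{A}$ be a C*-algebra and let $\mathcal{B}$ be a C*-subalgebra of $\mathcal{A}$. Assume that $\mathcal{B}$ contains a bounded approximate identity for $\mathcal{A}$. For $A \in \mathcal{A}$ let $L(A) = \inf\{\|A-B\| : B \in \mathcal{B}\}$. Then for any $A \in \mathcal{A}$ there is a non-degenerate $*$-representation $(\mathcal{H}, \pi)$ of $\mathcal{A}$ and a Hermitian unitary operator $U \in \mathcal{L}(\mathcal{H})$ such that $[U, \pi(B)] = 0$ for all $B \in \mathcal{B}$, and $$L(A) = \tfrac12 \|[U, \pi(A)]\|.$$ Furthermore, $L$ is the supremum of all the seminorms $L_{(\mathcal{H}, \pi, U)}$ defined by $L_{(\mathcal{H}, \pi, U)}(C) = \tfrac12 \|[U, \pi(C)]\|$ for $C \in \mathcal{A}$, as $(\mathcal{H}, \pi, U)$ ranges over all non-degenerate $*$-representations $(\mathcal{H}, \pi)$ of $\mathcal{A}$ and all Hermitian unitary elements $U \in \mathcal{L}(\mathcal{H})$ such that $[U, \pi(B)] = 0$ for all $B \in \mathcal{B}$. Each $L_{(\mathcal{H}, \pi, U)}$ is Leibniz, and hence so is $L$. If $\mathcal{A}$ is unital and if $1_{\mathcal{A}} \in \mathcal{B}$, then $L$ is strongly-Leibniz.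
   Context: C*-algebras are over $\mathbb{C}$ and C*-subalgebras are norm-closed $*$-subalgebras. $\mathcal{L}(\mathcal{H})$ is the algebra of bounded operators on the Hilbert space $\mathcal{H}$, and $[S,T] = ST - TS$. A seminorm $L$ on a C*-algebra $\mathcal{A}$ is Leibniz if $L(AC) \leq L(A)\|C\| + \|A\|L(C)$ for all $A, C \in \mathcal{A}$. If $\mathcal{A}$ is unital, $L$ is strongly-Leibniz if it is Leibniz, $L(1_{\mathcal{A}}) = 0$, and $L(A^{-1}) \leq \|A^{-1}\|^2 L(A)$ for every invertible $A \in \mathcal{A}$. *)

(* Defs.v *)
From HB Require Import structures.
From mathcomp Require Import all_boot all_order all_algebra.
From mathcomp Require Import complex.
From mathcomp Require Import all_classical all_reals all_analysis.

Set Implicit Arguments.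
Unset Strict Implicit.
Unset Printing Implicit Defensive.

Import Order.TTheory GRing.Theory Num.Theory.
Import numFieldNormedType.Exports.

Local Open Scope classical_set_scope.
Local Open Scope ring_scope.

(* The norm of a normed R[i]-module takes its values in R[i] (on the
   nonnegative real axis); [rnorm] is the same norm with values in R. *)
Definition rnorm (R : realType) (V : normedModType R[i]) (x : V) : R :=
  complex.Re `|x|.

Section RNorm.
Variables (R : realType) (V : normedModType R[i]).
Implicit Types x y : V.

Lemma rnormE x : (rnorm x)%:C%C = `|x|.
Proof. by apply: RRe_real; exact: normr_real. Qed.

Lemma rnorm_ge0 x : 0 <= rnorm x.
Proof. by rewrite -lecR rnormE; exact: normr_ge0. Qed.

Lemma rnormB x y : rnorm (x - y) <= rnorm x + rnorm y.
Proof. by rewrite -lecR rmorphD /= !rnormE ler_normB. Qed.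

End RNorm.

(* MathComp rings are unital, whereas a C*-algebra need not have a unit: the
   product is therefore a separate operation on a complex Banach space. *)
Record cstarAlgebra (R : realType) := CStarAlgebra {
  cstar_sort :> completeNormedModType R[i] ;
  amul : cstar_sort -> cstar_sort -> cstar_sort ;
  astar : cstar_sort -> cstar_sort ;
  amulA : forall a b c, amul a (amul b c) = amul (amul a b) c ;
  amulDl : forall a b c, amul (a + b) c = amul a c + amul b c ;
  amulDr : forall a b c, amul a (b + c) = amul a b + amul a c ;
  amulZl : forall (z : R[i]) a b, amul (z *: a) b = z *: amul a b ;
  amulZr : forall (z : R[i]) a b, amul a (z *: b) = z *: amul a b ;
  astarK : forall a, astar (astar a) = a ;
  astarD : forall a b, astar (a + b) = astar a + astar b ;
  astarZ : forall (z : R[i]) a, astar (z *: a) = Num.conj z *: astar a ;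
  astarM : forall a b, astar (amul a b) = amul (astar b) (astar a) ;
  norm_amul : forall a b, `|amul a b| <= `|a| * `|b| ;
  norm_astar_amul : forall a, `|amul (astar a) a| = `|a| ^+ 2
}.

Section CStarAlgebras.
Variables (R : realType) (A : cstarAlgebra R).

Record is_cstar_subalgebra (B : set A) : Prop := IsCStarSubalgebra {
  subalg0 : B 0 ;
  subalgD : forall a b, B a -> B b -> B (a + b) ;
  subalgZ : forall (z : R[i]) a, B a -> B (z *: a) ;
  subalgM : forall a b, B a -> B b -> B (amul a b) ;
  subalg_star : forall a, B a -> B (astar a) ;
  subalg_closed : closed B
}.

(* The filter of tails along which a net indexed by (I, le) converges. *)
Definition tails (I : Type) (le : rel I) : set_system I :=
  filter_from setT (fun i => [set j | le i j]).

Definition directed (I : Type) (le : rel I) : Prop :=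
  [/\ inhabited I, reflexive le, transitive le
    & forall i j, exists k, le i k /\ le j k].

(* Approximate identities are two-sided, as is usual. *)
Definition contains_bounded_approximate_identity (B : set A) : Prop :=
  exists (I : Type) (le : rel I) (e : I -> A),
    [/\ directed le,
        forall i, B (e i),
        exists M : R, forall i, rnorm (e i) <= M
      & forall a : A,
          (amul (e i) a @[i --> tails le] --> a) /\
          (amul a (e i) @[i --> tails le] --> a)].

Definition is_unit (one : A) : Prop :=
  forall a, amul one a = a /\ amul a one = a.

Record is_seminorm (L : A -> R) : Prop := IsSeminorm {
  seminorm_ge0 : forall a, 0 <= L a ;
  seminormD : forall a b, L (a + b) <= L a + L b ;
  seminormZ : forall (z : R[i]) a, L (z *: a) = complex.Re `|z| * L a
}.

Definition leibniz (L : A -> R) : Prop :=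
  is_seminorm L /\
  forall a c, L (amul a c) <= L a * rnorm c + rnorm a * L c.

Definition strongly_leibniz (one : A) (L : A -> R) : Prop :=
  [/\ leibniz L, L one = 0
    & forall a a', amul a a' = one -> amul a' a = one ->
        L a' <= rnorm a' ^+ 2 * L a].

Definition dist_to (B : set A) (a : A) : R :=
  inf [set rnorm (a - b) | b in B].

End CStarAlgebras.

(* The inner product is linear in its first argument and conjugate-linear in
   its second one. *)
Record hilbertSpace (R : realType) := HilbertSpace {
  hilbert_sort :> completeNormedModType R[i] ;
  inner : {dot hilbert_sort for Num.conj} ;
  inner_norm : forall x, inner x x = `|x| ^+ 2
}.

Definition linear_span (K : numFieldType) (V : lmodType K) (S : set V) : set V :=
  [set v | exists s : seq (K * V),
     (forall p, p \in s -> S p.2) /\ v = \sum_(p <- s) p.1 *: p.2].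

Record bounded_operator (R : realType) (H : hilbertSpace R) :=
  BoundedOperator {
  op :> {linear H -> H} ;
  op_bounded : exists M : R, forall x, rnorm (op x) <= M * rnorm x
}.

Section Operators.
Variables (R : realType) (H : hilbertSpace R).
Implicit Types S T U : bounded_operator H.

Definition opnorm T : R := sup [set rnorm (T x) | x in [set x | rnorm x <= 1]].

Lemma commutator_bounded S T :
  exists M : R, forall x, rnorm (((S \o T) \- (T \o S)) x) <= M * rnorm x.
Proof.
have [M SM] := op_bounded S; have [N TN] := op_bounded T.
have comp_le (P Q : H -> H) (p q : R) (x : H) :
    (forall y, rnorm (P y) <= p * rnorm y) ->
    (forall y, rnorm (Q y) <= q * rnorm y) ->
    rnorm (P (Q x)) <= `|p| * `|q| * rnorm x.
  move=> Pp Qq; rewrite -mulrA; apply: (le_trans (Pp _)).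
  apply: (@le_trans _ _ (`|p| * rnorm (Q x))).
    by apply: ler_wpM2r; [exact: rnorm_ge0 | exact: ler_norm].
  apply: ler_wpM2l => //; apply: (le_trans (Qq _)).
  by apply: ler_wpM2r; [exact: rnorm_ge0 | exact: ler_norm].
exists (`|M| * `|N| + `|N| * `|M|) => x /=.
rewrite mulrDl; apply: (le_trans (rnormB _ _)).
by apply: lerD; [exact: (comp_le S T) | exact: (comp_le T S)].
Qed.

Definition commutator S T : bounded_operator H :=
  @BoundedOperator R H ((S \o T) \- (T \o S) : {linear H -> H})
    (commutator_bounded S T).

Definition is_adjoint S T : Prop :=
  forall x y : H, inner H (S x) y = inner H x (T y).

Definition is_hermitian U : Prop := is_adjoint U U.

Definition is_unitary U : Prop :=
  exists V : bounded_operator H,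
    [/\ is_adjoint U V, forall x, V (U x) = x & forall x, U (V x) = x].

End Operators.

Record star_representation (R : realType) (A : cstarAlgebra R)
    (H : hilbertSpace R) := StarRepresentation {
  rep :> A -> bounded_operator H ;
  repD : forall a b x, rep (a + b) x = rep a x + rep b x ;
  repZ : forall (z : R[i]) a x, rep (z *: a) x = z *: rep a x ;
  repM : forall a b x, rep (amul a b) x = rep a (rep b x) ;
  rep_star : forall a, is_adjoint (rep a) (rep (astar a))
}.

Section Representations.
Variables (R : realType) (A : cstarAlgebra R) (B : set A).

Definition nondegenerate_rep (H : hilbertSpace R)
    (pi : star_representation A H) : Prop :=
  dense (linear_span [set y | exists a x, y = pi a x]).

Definition admissible (H : hilbertSpace R) (pi : star_representation A H)
    (U : bounded_operator H) : Prop :=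
  [/\ nondegenerate_rep pi, is_hermitian U, is_unitary U
    & forall b, B b -> forall x, commutator U (pi b) x = 0].

Definition commutator_seminorm (H : hilbertSpace R)
    (pi : star_representation A H) (U : bounded_operator H) (c : A) : R :=
  2^-1 * opnorm (commutator U (pi c)).

End Representations.

(* Main.v *)
Require Import Defs.
From HB Require Import structures.
From mathcomp Require Import all_boot all_order all_algebra.
From mathcomp Require Import complex.
From mathcomp Require Import all_classical all_reals all_analysis.
From mathcomp Require Import ring lra.
Import Order.TTheory GRing.Theory Num.Theory.
Import numFieldNormedType.Exports.
Local Open Scope classical_set_scope.
Local Open Scope ring_scope.

Set Implicit Arguments.
Unset Strict Implicit.
Unset Printing Implicit Defensive.

Local Notation "r *r: x" := (r%:C%C *: x) (at level 40).

(** The distance of [a] to [B] is realised by a functional: the Hahn-Banach theorem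
    gives a functional [u] of norm at most 1 that vanishes on [B] and takes the value
    [dist_to B a] at [a].  If there are a representation [pi] and two vectors [e1] and
    [e2] of norm at most 1 with [u c] the real part of the inner product of [pi c e1]
    and [e2], let [P] be the projection onto the closure of [pi B e1].  It commutes with
    [pi B]; it fixes [e1], because [B] contains an approximate identity; and it kills
    [e2], because [u] vanishes on [B].  With [T = 2 P - 1] the commutator [[T, pi a]]
    therefore has the matrix entry [- 2 u a] between [e1] and [e2], so that its norm is
    at least [2 dist_to B a] ([dist_attained]).  Conversely [[T, pi c]] equals
    [[T, pi (c - b)]] for [b] in [B], hence has norm at most [2 |c - b|]
    ([commutator_seminorm_le_dist]).  The Leibniz inequalities hold for each commutator
    seminorm, and pass to the distance because the distance is one of them at each
    single element.

    The two vectors come from a positive form.  A second use of the Hahn-Banach theorem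
    gives hermitian functionals [g1] and [g2] of norm at most 1 with
    [2 u (b^* a) <= g1 (a^* a) + g2 (b^* b)] ([exists_dominating]).  The matrix with
    diagonal entries [g1] and [g2] and off-diagonal entries [u] then defines a positive
    semidefinite form on pairs of elements, and the completion for this form carries
    the representation; [e1] and [e2] are the classes of [(1, 0)] and [(0, 1)].  What
    makes this second use possible is the Cauchy-Schwarz inequality
    [2 |sum b_i^* a_i| <= |sum a_i^* a_i| + |sum b_i^* b_i|] ([unorm_cauchy_schwarz]).

    This inequality depends on the positivity of the elements [a^* a], which is proved
    here without spectra or characters ([positive_starM]).  A selfadjoint [h] is called
    positive if [|1 - s h| <= 1 + o(s)] as [s] decreases to 0.  Sums of positive elements
    are visibly positive; squares of selfadjoint elements are positive by a computation
    with the C*-identity; and positive elements have approximate square roots, obtained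
    by an iteration.  For [a^* a], the estimate [unorm_swap] says that [a^* a] and
    [a a^*] have the same positive part, so that the negative part of [a^* a] is at most
    as large as its positive part, because [a^* a + a a^*] is a sum of squares.  Replacing
    [a] by [a (r - a^* a)] improves the constant by the factor [4 / 27], and iterating
    shows that the negative part vanishes. *)

(** * Complex scalars and real-valued norms *)

Section ComplexScalars.
Variable R : realType.
Implicit Types (z : R[i]) (r : R).

Lemma conj_real r : Num.conj (r%:C%C : R[i]) = r%:C%C.
Proof. by apply/CrealP; rewrite complex_real. Qed.

Lemma conj_i : Num.conj ('i%C : R[i]) = - 'i%C.
Proof. by apply/eqP; rewrite eq_complex /= oppr0 !eqxx. Qed.

Lemma conj_Ni : Num.conj (- 'i%C : R[i]) = 'i%C.
Proof. by rewrite -conj_i conjCK. Qed.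

Lemma mulii : 'i%C * 'i%C = -1 :> R[i].
Proof. by rewrite -expr2 sqr_i. Qed.

Lemma Re_norm_real r : complex.Re `|r%:C%C : R[i]| = `|r|.
Proof. by rewrite normc_def /= expr0n addr0 sqrtr_sqr. Qed.

Lemma Re_normE (z : R[i]) : (complex.Re `|z|)%:C%C = `|z|.
Proof. by rewrite RRe_real// normr_real. Qed.

Lemma Re_norm_ge0 (z : R[i]) : 0 <= complex.Re `|z|.
Proof. by rewrite -lecR Re_normE; exact: normr_ge0. Qed.

Lemma gt0_real (e : R[i]) : 0 < e -> exists2 r : R, 0 < r & e = r%:C%C.
Proof.
move=> e0; have er : (complex.Re e)%:C%C = e by rewrite RRe_real// gtr0_real.
by exists (complex.Re e); rewrite ?er// -ltcR er.
Qed.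

(** The inequality for the inverse scalar is the converse inequality. *)
Lemma homogeneous_of_le (V : lmodType R[i]) (L : V -> R) :
  (forall x, 0 <= L x) ->
  (forall (z : R[i]) x, L (z *: x) <= complex.Re `|z| * L x) ->
  forall (z : R[i]) x, L (z *: x) = complex.Re `|z| * L x.
Proof.
move=> L0 LZ z x; apply/eqP; rewrite eq_le LZ andTb.
have [->|r0] := eqVneq (complex.Re `|z|) 0; first by rewrite mul0r.
have z0 : z != 0.
  by apply: contra_neq r0 => ->; exact: etrans (Re_norm_real 0) (normr0 R).
have zp : 0 < complex.Re `|z| by rewrite lt_neqAle eq_sym r0 Re_norm_ge0.
have := LZ z^-1 (z *: x); rewrite scalerA mulVf// scale1r.
have -> : complex.Re `|z^-1| = (complex.Re `|z|)^-1.
  by apply: (@complexI R); rewrite fmorphV !Re_normE normfV.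
by rewrite ler_pdivlMl.
Qed.

End ComplexScalars.

Section RealNorm.
Variables (R : realType) (V : normedModType R[i]).
Implicit Types (x y : V).

Lemma rnorm_ltE x (e : R) : (rnorm x < e) = (`|x| < e%:C%C).
Proof. by rewrite -ltcR rnormE. Qed.

Lemma cvg_rnormP (T : Type) (F : set_system T) (FF : Filter F) (f : T -> V) (l : V) :
  f @ F --> l <-> forall e : R, 0 < e -> \forall x \near F, rnorm (l - f x) < e.
Proof.
split=> [fl e e0|H].
  have e0' : 0 < e%:C%C :> R[i] by rewrite ltcR.
  have /cvgrPdist_lt/(_ _ e0') := fl.
  by apply: filterS => x; rewrite rnorm_ltE.
apply/cvgrPdist_lt => _ /gt0_real[e e0 ->].
by apply: filterS (H e e0) => x; rewrite rnorm_ltE.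
Qed.

Lemma rnormZ (z : R[i]) x : rnorm (z *: x) = complex.Re `|z| * rnorm x.
Proof.
apply: (@complexI R); rewrite rnormE rmorphM normrZ; congr (_ * _).
exact: (esym (rnormE x)).
Qed.

Lemma rnormZr (r : R) x : rnorm (r *r: x) = `|r| * rnorm x.
Proof. by rewrite rnormZ Re_norm_real. Qed.

Lemma rnorm0 : rnorm (0 : V) = 0.
Proof. by rewrite /rnorm normr0. Qed.

Lemma rnormN x : rnorm (- x) = rnorm x.
Proof. by rewrite /rnorm normrN. Qed.

Lemma rnormD x y : rnorm (x + y) <= rnorm x + rnorm y.
Proof. by rewrite -[y in leLHS]opprK -(rnormN y) rnormB. Qed.

Lemma rnorm_eq0 x : rnorm x = 0 -> x = 0.
Proof. by move=> x0; apply/normr0_eq0; rewrite -rnormE x0. Qed.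

End RealNorm.

Section OperatorSup.
Variables (R : realType) (V W : normedModType R[i]) (T : V -> W).

Definition opsup : R := sup [set rnorm (T x) | x in [set x | rnorm x <= 1]].

Lemma opsup_nonempty : [set rnorm (T x) | x in [set x | rnorm x <= 1]] !=set0.
Proof. by exists (rnorm (T 0)); exists 0 => //=; rewrite rnorm0. Qed.

Lemma opsup_le (M : R) : 0 <= M -> (forall x, rnorm (T x) <= M * rnorm x) -> opsup <= M.
Proof.
move=> M0 TM; apply: ge_sup; first exact: opsup_nonempty.
move=> _ [x /= x1 <-]; apply: le_trans (TM x) _.
by rewrite ler_piMr.
Qed.

Hypothesis TZ : forall (z : R[i]) x, T (z *: x) = z *: T x.
Hypothesis Tbd : exists M : R, forall x, rnorm (T x) <= M * rnorm x.

Lemma opsup_ub x : rnorm x <= 1 -> rnorm (T x) <= opsup.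
Proof.
move=> x1; apply: sup_upper_bound; last by exists x.
split; first exact: opsup_nonempty.
have [M TM] := Tbd; exists `|M| => _ [y /= y1 <-]; apply: le_trans (TM y) _.
apply: le_trans (ler_wpM2r (rnorm_ge0 y) (ler_norm M)) _.
by rewrite ler_piMr.
Qed.

Lemma opsup_ge0 : 0 <= opsup.
Proof. by apply: le_trans (@opsup_ub 0 _); rewrite ?rnorm_ge0// rnorm0. Qed.

Lemma opsup_bound x : rnorm (T x) <= opsup * rnorm x.
Proof.
have [x0|x0] := eqVneq (rnorm x) 0.
  have [M TM] := Tbd; have := TM x; rewrite x0 !mulr0.
  by [].
have xp : 0 < rnorm x by rewrite lt_neqAle eq_sym x0 rnorm_ge0.
have := @opsup_ub ((rnorm x)^-1 *r: x).
rewrite TZ !rnormZr ger0_norm ?invr_ge0 ?rnorm_ge0// mulVf// => /(_ (lexx _)).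
by rewrite ler_pdivrMl// mulrC.
Qed.

End OperatorSup.

(** * Elementary real estimates *)

Section RealEstimates.
Variable R : realType.
Implicit Types (r s t e : R).

Lemma exists_expr_lt r e : 0 <= r -> r < 1 -> 0 < e -> exists n : nat, r ^+ n < e.
Proof.
move=> r0 r1 e0.
have : (fun n => r ^+ n) @ \oo --> (0 : R) by apply: cvg_expr; rewrite ger0_norm.
move/cvgrPdist_lt => /(_ e e0) [n _ /(_ n (leqnn n))] /=.
by rewrite sub0r normrN normrX ger0_norm// => rn; exists n.
Qed.

Lemma bernoulli_le r n : 0 <= r -> 1 + n%:R * r <= (1 + r) ^+ n.
Proof.
move=> r0; elim: n => [|n IH]; first by rewrite mul0r addr0.
rewrite exprS -natr1.
have := ler_wpM2l (addr_ge0 ler01 r0) IH.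
have := mulr_ge0 (mulr_ge0 (ler0n R n) r0) r0; lra.
Qed.

(** Polynomial factors disappear under [2^k]-th roots.  If [r] exceeded [t], then the
    powers of [r / t] would grow faster than linearly. *)
Lemma le_of_expr_exp2 r t (C : R) : 1 <= t -> 0 <= r ->
  (forall k : nat, r ^+ (2 ^ k)%N <= 1 + C * (2 ^ k)%:R * t ^+ (2 ^ k)%N) -> r <= t.
Proof.
move=> t1 r0 H; rewrite leNgt; apply/negP => tr.
have t0 : 0 < t by lra.
pose d := r / t - 1; have d0 : 0 < d by rewrite subr_gt0 ltr_pdivlMr// mul1r.
have rE : r = (1 + d) * t by rewrite /d addrC subrK mulfVK// gt_eqF.
have B (k : nat) : (1 + d) ^+ (2 ^ k)%N <= 1 + C * (2 ^ k)%:R.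
  have tk : 1 <= t ^+ (2 ^ k)%N by exact: exprn_ege1.
  have tk0 : 0 < t ^+ (2 ^ k)%N by exact: exprn_gt0.
  rewrite -(ler_pM2r tk0) -exprMn -rE; apply: le_trans (H k) _; lra.
have key (k : nat) : (2 ^ k)%:R * (d * d) <= 2 * C.
  have := B k.+1; rewrite expnSr exprM.
  have := bernoulli_le (2 ^ k) (ltW d0).
  move: (_ ^+ (2 ^ k)%N) => w hw.
  have m0 : 0 < (2 ^ k)%:R :> R by rewrite ltr0n expn_gt0.
  move: hw; rewrite natrM; move: (_%:R) m0 => m m0 hw hB.
  have md : 0 < m * d by rewrite mulr_gt0.
  have := ler_pM (addr_ge0 ler01 (ltW md)) (addr_ge0 ler01 (ltW md)) hw hw.
  by rewrite expr2 in hB; rewrite -[_ <= 2 * C](ler_pM2l m0); lra.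
have [n Hn] : exists n : nat, 2 * C / (d * d) < n%:R.
  by exists (Num.truncn (2 * C / (d * d))).+1; exact: Num.Theory.truncnS_gt.
have := key n; apply/negP; rewrite -ltNge -ltr_pdivrMr ?mulr_gt0//.
by apply: lt_trans Hn _; rewrite ltr_nat ltn_expl.
Qed.

Lemma sq_small_eq0 (x K : R) :
  (forall e, 0 < e -> e <= 1 -> x ^+ 2 <= K * e) -> x = 0.
Proof.
move=> H; apply/eqP; rewrite -sqrf_eq0 eq_le sqr_ge0 andbT.
apply/ler_addgt0Pr => e e0; rewrite add0r.
have K0 : 0 <= K by have := H 1 ltr01 (lexx 1); have := sqr_ge0 x; lra.
pose d := Num.min 1 (e / (1 + K)).
have K1 : 0 < 1 + K by lra.
have d0 : 0 < d by rewrite lt_min ltr01 divr_gt0.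
apply: le_trans (H d d0 _) _; first by rewrite ge_min lexx.
apply: (@le_trans _ _ (K * (e / (1 + K)))).
  by rewrite ler_wpM2l// ge_min lexx orbT.
by rewrite mulrCA ler_piMr ?(ltW e0)// ler_pdivrMr// mul1r; lra.
Qed.

End RealEstimates.

(** * The Hahn-Banach theorem *)

Section HahnBanach.
Variables (R : realType) (V : lmodType R[i]).
Implicit Types (p q u : V -> R) (x y : V) (r t : R).

Lemma rscaleA r t x : r *r: (t *r: x) = (r * t) *r: x.
Proof. by rewrite scalerA -rmorphM. Qed.

Lemma rscaleDl r t x : (r + t) *r: x = r *r: x + t *r: x.
Proof. by rewrite rmorphD scalerDl. Qed.

Lemma rscale1 x : 1 *r: x = x.
Proof. by rewrite rmorph1 scale1r. Qed.

Lemma rscale0 x : 0 *r: x = 0.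
Proof. by rewrite rmorph0 scale0r. Qed.

Lemma rscale2 x : 2 *r: x = x + x.
Proof. by rewrite -[in RHS](rscale1 x) -rscaleDl. Qed.

Definition sublinear p :=
  (forall x y, p (x + y) <= p x + p y) /\
  (forall r x, 0 <= r -> p (r *r: x) = r * p x).

Definition real_linear u :=
  (forall x y, u (x + y) = u x + u y) /\ (forall r x, u (r *r: x) = r * u x).

Lemma real_linear0 u : real_linear u -> u 0 = 0.
Proof. by move=> [_ uZ]; rewrite -(rscale0 0) uZ mul0r. Qed.

Lemma real_linearN u x : real_linear u -> u (- x) = - u x.
Proof. by move=> [_ uZ]; rewrite -scaleN1r -(rmorph1 (real_complex R)) -rmorphN uZ mulN1r. Qed.

Lemma sublinear_intro p :
  (forall x y, p (x + y) <= p x + p y) -> p 0 <= 0 ->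
  (forall r x, 0 < r -> p (r *r: x) <= r * p x) -> sublinear p.
Proof.
move=> pD p0 pZ; split=> // r x; rewrite le_eqVlt => /orP[/eqP<-|r0].
  rewrite rscale0 mul0r; apply/eqP; rewrite eq_le p0/=.
  by have := pD 0 0; rewrite addr0; lra.
apply/eqP; rewrite eq_le pZ//=.
have := pZ r^-1 (r *r: x); rewrite invr_gt0 => /(_ r0).
by rewrite rscaleA mulVf ?gt_eqF// rscale1 ler_pdivlMl.
Qed.

Lemma sublinear0 p : sublinear p -> p 0 = 0.
Proof. by move=> [_ pZ]; rewrite -[0](rscale0 0) pZ ?mul0r. Qed.

Lemma sublinear_geN p x : sublinear p -> - p (- x) <= p x.
Proof.
move=> hp; have := hp.1 x (- x).
by rewrite subrr (sublinear0 hp); lra.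
Qed.

(** This construction makes a sublinear functional linear on the line through [x0]
    without raising it anywhere. *)
Definition ray_inf q x0 x : R :=
  inf [set v | exists2 t, 0 <= t & v = q (x + t *r: x0) - t * q x0].

Section RayInf.
Variables (q : V -> R) (x0 : V) (hq : sublinear q).

Lemma ray_inf_lb x v :
  (exists2 t, 0 <= t & v = q (x + t *r: x0) - t * q x0) -> - q (- x) <= v.
Proof.
move=> [t t0 ->]; rewrite -hq.2//.
have := hq.1 (x + t *r: x0) (- x); rewrite addrAC subrr add0r; lra.
Qed.

Lemma ray_inf_le x t : 0 <= t -> ray_inf q x0 x <= q (x + t *r: x0) - t * q x0.
Proof.
move=> t0; apply: ge_inf; last by exists t.
by exists (- q (- x)) => v; exact: ray_inf_lb.
Qed.

Lemma ray_inf_ge x m :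
  (forall t, 0 <= t -> m <= q (x + t *r: x0) - t * q x0) -> m <= ray_inf q x0 x.
Proof.
move=> h; apply: lb_le_inf; last by move=> v [t t0 ->]; exact: h.
by exists (q (x + 0 *r: x0) - 0 * q x0); exists 0.
Qed.

Lemma ray_inf_sublinear : sublinear (ray_inf q x0).
Proof.
apply: sublinear_intro.
- move=> x y; rewrite -lerBlDr; apply: ray_inf_ge => s s0.
  rewrite lerBlDr -lerBlDl; apply: ray_inf_ge => t t0.
  rewrite lerBlDl; apply: le_trans (ray_inf_le _ (addr_ge0 s0 t0)) _.
  rewrite rscaleDl addrACA.
  by have := hq.1 (x + s *r: x0) (y + t *r: x0); lra.
- have := ray_inf_le 0 (lexx 0).
  by rewrite rscale0 addr0 (sublinear0 hq) mul0r subr0.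
- move=> r x r0; rewrite -ler_pdivrMl//; apply: ray_inf_ge => t t0.
  rewrite ler_pdivrMl//; apply: le_trans (ray_inf_le _ (mulr_ge0 (ltW r0) t0)) _.
  by rewrite -rscaleA -scalerDr (hq.2 _ _ (ltW r0)) mulrBr mulrA.
Qed.

Lemma ray_inf_le_self x : ray_inf q x0 x <= q x.
Proof.
by have := ray_inf_le x (lexx 0); rewrite rscale0 addr0 mul0r subr0.
Qed.

Lemma ray_inf_opp : ray_inf q x0 (- x0) <= - q x0.
Proof.
have := ray_inf_le (- x0) ler01.
by rewrite rscale1 addNr (sublinear0 hq) mul1r sub0r.
Qed.

End RayInf.

(** A minimal sublinear functional [q] is linear: the functional lowered along
    the ray of [x] is no smaller than [q], which forces [q (- x) = - q x]. *)
Lemma minimal_sublinear_linear q : sublinear q ->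
  (forall q', sublinear q' -> (forall x, q' x <= q x) -> forall x, q x <= q' x) ->
  real_linear q.
Proof.
move=> hq qmin.
have qN x : q (- x) = - q x.
  apply/eqP; rewrite eq_le; apply/andP; split.
    apply: le_trans (ray_inf_opp x hq).
    apply: qmin; first exact: ray_inf_sublinear.
    exact: ray_inf_le_self.
  by have := sublinear_geN (- x) hq; rewrite opprK.
split=> [x y|r x].
  apply/eqP; rewrite eq_le hq.1/=.
  have := hq.1 (x + y) (- y); rewrite addrK qN; lra.
have [r0|r0] := leP 0 r; first exact: hq.2.
have := hq.2 (- r) x; rewrite oppr_ge0 (ltW r0) => /(_ isT).
by rewrite rmorphN scaleNr qN mulNr => /oppr_inj.
Qed.

(** Zorn's lemma applies: the infimum of a chain of sublinear functionals below [p] is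
    finite, because each of them is at least [- p (- x)] at [x]. *)
Lemma exists_minimal_sublinear p : sublinear p ->
  exists q, [/\ sublinear q, forall x, q x <= p x &
    forall q', sublinear q' -> (forall x, q' x <= q x) -> forall x, q x <= q' x].
Proof.
move=> hp; pose T := {q : V -> R | sublinear q /\ forall x, q x <= p x}.
pose le (f g : T) : bool := `[< forall x, sval g x <= sval f x >].
have [f fmax] : exists t : T, forall s, le t s -> s = t.
  apply: Zorn.
  - by move=> t; apply/asboolP => x.
  - move=> r s t /asboolP rs /asboolP st; apply/asboolP => x.
    exact: le_trans (st x) (rs x).
  - move=> [f hf] [g hg] /asboolP/= fg /asboolP/= gf; apply: eq_exist.
    by apply/funext => x; apply/eqP; rewrite eq_le fg gf.
  move=> C Ctot.
  have [[f0 Cf0]|C0] := pselect (exists f, C f); last first.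
    exists (exist _ p (conj hp (fun x => lexx (p x)))) => s Cs.
    by case: C0; exists s.
  pose S x := [set sval f x | f in C].
  have Slb x : has_lbound (S x).
    exists (- p (- x)) => _ [f Cf <-].
    have [hf fp] := svalP f.
    by apply: le_trans (sublinear_geN x hf); rewrite lerN2.
  have Sle f x : C f -> inf (S x) <= sval f x.
    by move=> Cf; apply: ge_inf; [exact: Slb | exists f].
  have Sge x m : (forall f, C f -> m <= sval f x) -> m <= inf (S x).
    move=> h; apply: lb_le_inf; first by exists (sval f0 x); exists f0.
    by move=> _ [f Cf <-]; exact: h.
  have hS : sublinear (fun x => inf (S x)).
    apply: sublinear_intro.
    - move=> x y; rewrite -lerBlDr; apply: (Sge) => f Cf.
      rewrite lerBlDr -lerBlDl; apply: (Sge) => g Cg; rewrite lerBlDl.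
      have [/asboolP fg|/asboolP gf] := Ctot _ _ Cf Cg.
      + apply: le_trans (Sle g _ Cg) _; apply: le_trans ((svalP g).1.1 _ _) _.
        by rewrite lerD2r.
      + apply: le_trans (Sle f _ Cf) _; apply: le_trans ((svalP f).1.1 _ _) _.
        by rewrite lerD2l.
    - by apply: le_trans (Sle f0 _ Cf0) _; rewrite (sublinear0 (svalP f0).1).
    - move=> r x r0; rewrite -ler_pdivrMl//; apply: (Sge) => f Cf.
      by rewrite ler_pdivrMl// -(svalP f).1.2 ?(ltW r0)//; exact: Sle.
  have Sp x : inf (S x) <= p x.
    exact: le_trans (Sle f0 _ Cf0) ((svalP f0).2 x).
  exists (exist _ (fun x => inf (S x)) (conj hS Sp) : T) => s Cs.
  by apply/asboolP => x /=; exact: Sle.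
exists (sval f); have [hf fp] := svalP f; split=> // q' hq' q'f x.
have q'p y : q' y <= p y by exact: le_trans (q'f y) (fp y).
have := fmax (exist _ q' (conj hq' q'p) : T).
by rewrite /le /= => /(_ (asboolT q'f)) <-.
Qed.

(** Lowering [p] along the ray of [x0] first makes every minorant [u] satisfy
    [u (- x0) <= - p x0], which for a linear [u] is [p x0 <= u x0]. *)
Lemma hahn_banach p x0 : sublinear p ->
  exists u, [/\ real_linear u, forall x, u x <= p x & u x0 = p x0].
Proof.
move=> hp.
have [u [hu up umin]] := exists_minimal_sublinear (ray_inf_sublinear x0 hp).
have ulin := minimal_sublinear_linear hu umin.
have ulep x : u x <= p x by exact: le_trans (up x) (ray_inf_le_self _ hp x).
exists u; split=> //; apply/eqP; rewrite eq_le ulep/=.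
have := le_trans (up (- x0)) (ray_inf_opp x0 hp).
by have := ulin.2 (-1) x0; rewrite rmorphN rmorph1 scaleN1r => ->; lra.
Qed.

End HahnBanach.

(** * C*-seminorms and the logarithmic norm *)

(** Only a seminorm is required: the seminorm that the unitization of [A] gets from left
    multiplication on [A] is degenerate when [A] has a unit, and it vanishes at 1 when
    [A] is 0. *)
Record cstarSeminormed (R : realType) := CStarSeminormed {
  ualg :> algType R[i] ;
  ustar : ualg -> ualg ;
  unorm : ualg -> R ;
  ustarK : forall x, ustar (ustar x) = x ;
  ustarD : forall x y, ustar (x + y) = ustar x + ustar y ;
  ustarZ : forall (z : R[i]) x, ustar (z *: x) = Num.conj z *: ustar x ;
  ustarM : forall x y, ustar (x * y) = ustar y * ustar x ;
  unormD : forall x y, unorm (x + y) <= unorm x + unorm y ;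
  unormZ : forall (z : R[i]) x, unorm (z *: x) = complex.Re `|z| * unorm x ;
  unormM : forall x y, unorm (x * y) <= unorm x * unorm y ;
  unorm1 : unorm 1 <= 1 ;
  unorm_star : forall x, unorm (ustar x * x) = unorm x ^+ 2
}.

Section CStarSeminormedTheory.
Variables (R : realType) (U : cstarSeminormed R).
Implicit Types (x y a b c h k p q : U) (r s t e : R).
Local Notation N := (@unorm R U).
Local Notation "x ^#" := (ustar x).

Lemma half_double x : 2^-1 *r: (x + x) = x.
Proof. by rewrite -rscale2 rscaleA mulVf// rscale1. Qed.

Lemma unormZr r x : N (r *r: x) = `|r| * N x.
Proof. by rewrite unormZ Re_norm_real. Qed.

Lemma unormZp r x : 0 <= r -> N (r *r: x) = r * N x.
Proof. by move=> r0; rewrite unormZr ger0_norm. Qed.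

Lemma unormN x : N (- x) = N x.
Proof. by have := unormZr (-1) x; rewrite rmorphN rmorph1 scaleN1r normrN1 mul1r. Qed.

Lemma unorm0 : N 0 = 0.
Proof. by rewrite -[0](scale0r 0) -[0 in LHS](rmorph0 (real_complex R)) unormZr normr0 mul0r. Qed.

Lemma unorm_ge0 x : 0 <= N x.
Proof. by have := unormD x (- x); rewrite subrr unorm0 unormN; lra. Qed.

Lemma unormB x y : N (x - y) <= N x + N y.
Proof. by rewrite -(unormN y) unormD. Qed.

Lemma unorm_distC x y : N (x - y) = N (y - x).
Proof. by rewrite -opprB unormN. Qed.

Lemma unorm_le_star x : N x <= N x^#.
Proof.
have := unormM x^# x; rewrite unorm_star expr2.
have [->|x0] := eqVneq (N x) 0; first by rewrite unorm_ge0.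
by rewrite ler_pM2r// lt_neqAle eq_sym x0 unorm_ge0.
Qed.

Lemma unormS x : N x^# = N x.
Proof.
apply/eqP; rewrite eq_le unorm_le_star andbT.
by have := unorm_le_star x^#; rewrite ustarK.
Qed.

Lemma ustarZr r x : (r *r: x)^# = r *r: x^#.
Proof. by rewrite ustarZ conj_real. Qed.

Lemma ustarN x : (- x)^# = - x^#.
Proof. by have := ustarZr (-1) x; rewrite rmorphN rmorph1 !scaleN1r. Qed.

Lemma ustarB x y : (x - y)^# = x^# - y^#.
Proof. by rewrite ustarD ustarN. Qed.

Lemma ustar0 : (0 : U)^# = 0.
Proof. by have := ustarB 0 0; rewrite !subrr. Qed.

Lemma ustar1 : (1 : U)^# = 1.
Proof. by rewrite -[LHS]mul1r -[X in X * _]ustarK -ustarM mul1r ustarK. Qed.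

Lemma ustar_sum (I : Type) (l : seq I) (F : I -> U) :
  (\sum_(i <- l) F i)^# = \sum_(i <- l) (F i)^#.
Proof. exact: (big_morph (@ustar R U) (@ustarD R U) ustar0). Qed.

Definition selfadjoint x := x^# = x.

Lemma selfadjoint_starM x : selfadjoint (x^# * x).
Proof. by rewrite /selfadjoint ustarM ustarK. Qed.

Lemma selfadjointZ r x : selfadjoint x -> selfadjoint (r *r: x).
Proof. by rewrite /selfadjoint ustarZr => ->. Qed.

Lemma selfadjointD x y : selfadjoint x -> selfadjoint y -> selfadjoint (x + y).
Proof. by rewrite /selfadjoint ustarD => -> ->. Qed.

Lemma selfadjointN x : selfadjoint x -> selfadjoint (- x).
Proof. by rewrite /selfadjoint ustarN => ->. Qed.

Lemma selfadjoint1 : selfadjoint 1.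
Proof. exact: ustar1. Qed.

Lemma selfadjointM x y : x * y = y * x ->
  selfadjoint x -> selfadjoint y -> selfadjoint (x * y).
Proof. by rewrite /selfadjoint ustarM => xy -> ->. Qed.

Lemma unorm_sq x : selfadjoint x -> N (x * x) = N x ^+ 2.
Proof. by move=> sx; rewrite -[X in N (X * _)]sx unorm_star. Qed.

Lemma unorm_sq_add x y : selfadjoint x -> selfadjoint y -> x * y = y * x ->
  N (x + 'i%C *: y) ^+ 2 = N (x * x + y * y).
Proof.
move=> sx sy xy; rewrite -unorm_star ustarD ustarZ sx sy conj_i; congr N.
rewrite mulrDl !mulrDr -!scalerAl -!scalerAr scalerA mulNr mulii opprK scale1r.
by rewrite xy scaleNr addrA addrK.
Qed.

(** For commuting selfadjoint [x] and [y] the normal element [x + i y] has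
    square norm [|x^2 + y^2|] and real part [x]. *)
Lemma unorm_sq_le_add x y : selfadjoint x -> selfadjoint y -> x * y = y * x ->
  N (x * x) <= N (x * x + y * y).
Proof.
move=> sx sy xy; rewrite unorm_sq// -unorm_sq_add//.
rewrite ler_pXn2r ?nnegrE ?unorm_ge0//.
set z := x + _; have := unormD z z^#.
suff -> : z + z^# = 2 *r: x by rewrite unormS unormZp//; lra.
rewrite /z ustarD ustarZ sx sy conj_i scaleNr addrACA subrr addr0.
by rewrite -{1 2}(rscale1 x) -rscaleDl.
Qed.

(** The logarithmic norm of [h] is the right derivative at 0 of the convex function that
    sends [s] to [|1 + s h|].  By convexity a single [s] for each [e] bounds it. *)
Definition log_norm_le h r :=
  forall e, 0 < e -> exists2 s, 0 < s & N (1 + s *r: h) <= 1 + s * (r + e).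

(** The map sending [s] to [|1 + s h|] is convex and at most 1 at 0. *)
Lemma log_norm_le_small h r e : log_norm_le h r -> 0 < e ->
  exists2 s0, 0 < s0 & forall s, 0 < s -> s <= s0 ->
    N (1 + s *r: h) <= 1 + s * (r + e).
Proof.
move=> hr e0; have [s0 s00 Hs] := hr e e0; exists s0 => // s sp ss.
have cs : 0 <= s / s0 by rewrite divr_ge0 ?ltW.
have cs1 : s / s0 <= 1 by rewrite ler_pdivrMr// mul1r.
have -> : 1 + s *r: h = (1 - s / s0) *r: 1 + (s / s0) *r: (1 + s0 *r: h).
  rewrite scalerDr rscaleA mulfVK ?gt_eqF// addrA -rscaleDl subrK.
  by rewrite rscale1.
apply: le_trans (unormD _ _) _; rewrite !unormZp ?subr_ge0//.
have h1 : (1 - s / s0) * N 1 <= (1 - s / s0) * 1.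
  by rewrite ler_wpM2l ?subr_ge0// unorm1.
have h2 : (s / s0) * N (1 + s0 *r: h) <= (s / s0) * (1 + s0 * (r + e)).
  by rewrite ler_wpM2l.
apply: le_trans (lerD h1 h2) _.
by rewrite mulrDr [s / s0 * (s0 * _)]mulrA mulfVK ?gt_eqF//; lra.
Qed.

Lemma log_norm_leW h r r' : r <= r' -> log_norm_le h r -> log_norm_le h r'.
Proof.
move=> rr hr e e0; have [s s0 Hs] := hr e e0; exists s => //.
by apply: le_trans Hs _; rewrite lerD2l (ler_wpM2l (ltW s0))// lerD2r.
Qed.

Lemma log_norm_le_lim h r :
  (forall e, 0 < e -> log_norm_le h (r + e)) -> log_norm_le h r.
Proof.
move=> H e e0; have e2 : 0 < e / 2 by rewrite divr_gt0.
have [s s0 Hs] := H _ e2 _ e2; exists s => //.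
by rewrite -addrA -splitr in Hs.
Qed.

Lemma log_norm_leD h k r t :
  log_norm_le h r -> log_norm_le k t -> log_norm_le (h + k) (r + t).
Proof.
move=> hr kt e e0; have e2 : 0 < e / 2 by rewrite divr_gt0.
have [s1 s10 H1] := log_norm_le_small hr e2.
have [s2 s20 H2] := log_norm_le_small kt e2.
pose s := Num.min s1 s2.
have s0 : 0 < s by rewrite lt_min s10.
exists (s / 2); first by rewrite divr_gt0.
have -> : 1 + (s / 2) *r: (h + k) = 2^-1 *r: (1 + s *r: h) + 2^-1 *r: (1 + s *r: k).
  rewrite -scalerDr addrACA [RHS]scalerDr half_double; congr (_ + _).
  by rewrite -scalerDr rscaleA mulrC.
apply: le_trans (unormD _ _) _; rewrite !unormZp ?invr_ge0//.
have := H1 s s0; rewrite ge_min lexx => /(_ isT).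
have := H2 s s0; rewrite ge_min lexx orbT => /(_ isT).
lra.
Qed.

Lemma log_norm_leZ (c : R) h r : 0 < c -> log_norm_le h r -> log_norm_le (c *r: h) (c * r).
Proof.
move=> c0 hr e e0; have [s s0 Hs] := hr (e / c) (divr_gt0 e0 c0).
exists (s / c); first by rewrite divr_gt0.
rewrite rscaleA mulfVK ?gt_eqF//; apply: le_trans Hs _.
suff -> : s / c * (c * r + e) = s * (r + e / c) by [].
by field; rewrite gt_eqF.
Qed.

Lemma log_norm_le_norm h : log_norm_le h (N h).
Proof.
move=> e e0; exists 1 => //; rewrite rscale1 mul1r.
by apply: le_trans (unormD _ _) _; have := unorm1 U; lra.
Qed.

Lemma log_norm_le_const t : log_norm_le (t *r: 1) t.
Proof.
move=> e e0; exists (1 + `|t|)^-1; first by rewrite invr_gt0 ltr_pwDl.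
have t1 : 0 < 1 + `|t| by rewrite ltr_pwDl.
rewrite rscaleA -{1}(rscale1 1) -rscaleDl.
have h0 : 0 <= 1 + (1 + `|t|)^-1 * t.
  rewrite -(pmulr_rge0 _ t1) mulrDr mulr1 mulrA mulfV ?gt_eqF// mul1r.
  by have := ler_norm (- t); rewrite normrN; lra.
rewrite unormZp//; apply: (le_trans (ler_wpM2l h0 (unorm1 U))).
rewrite mulr1 lerD2l mulrDr lerDl.
by rewrite mulr_ge0// ?invr_ge0 ltW.
Qed.

Lemma log_norm_le_near h k r : log_norm_le k r -> log_norm_le h (r + N (h - k)).
Proof.
by move=> kr; have := log_norm_leD kr (log_norm_le_norm (h - k)); rewrite addrC subrK.
Qed.

(** This notion needs no spectrum, and is stable under sums by subadditivity of the
    logarithmic norm.  It controls only the real part of [p], and is used together with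
    selfadjointness. *)
Definition positive p := log_norm_le (- p) 0.

Lemma positiveD p q : positive p -> positive q -> positive (p + q).
Proof. by move=> hp hq; have := log_norm_leD hp hq; rewrite -opprD addr0. Qed.

Lemma positiveZ r p : 0 < r -> positive p -> positive (r *r: p).
Proof. by move=> r0 hp; have := log_norm_leZ r0 hp; rewrite scalerN mulr0. Qed.

Lemma positive_lim p :
  (forall e, 0 < e -> exists2 q, positive q & N (p - q) <= e) -> positive p.
Proof.
move=> H; apply: log_norm_le_lim => e e0; have [q hq pq] := H e e0.
apply: log_norm_leW (log_norm_le_near (- p) hq).
by rewrite -opprD unormN lerD2l.
Qed.

Lemma log_norm_le_positive h r : log_norm_le h r <-> positive (r *r: 1 - h).
Proof.
split=> [hr|hp].
  have := log_norm_leD hr (log_norm_le_const (- r)).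
  by rewrite subrr rmorphN scaleNr /positive opprB.
have := log_norm_leD hp (log_norm_le_const r).
by rewrite add0r opprB subrK.
Qed.

Lemma positive_norm_sub p : positive (N p *r: 1 - p).
Proof. exact: (log_norm_le_positive p (N p)).1 (log_norm_le_norm p). Qed.

(** Since [|(2 - k^2) + 2 i k|^2 = |4 + k^4|], the real part [2 - k^2] has norm at most
    [2 + |k|^4/4]: the norm of [1 - s k^2] exceeds 1 only to second order in [s]. *)
Lemma unorm_sub_sq k : selfadjoint k -> N (2 *r: 1 - k * k) <= 2 + N k ^+ 4 / 4.
Proof.
move=> sk; set a := 2 *r: 1 - k * k; set b := 2 *r: k.
have sa : selfadjoint a.
  apply: selfadjointD; first exact: selfadjointZ selfadjoint1.
  by apply: selfadjointN; exact: selfadjointM.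
have sb : selfadjoint b by exact: selfadjointZ.
have ab : a * b = b * a.
  rewrite /a /b mulrBl mulrBr -!scalerAl -!scalerAr mul1r mulr1.
  by rewrite mulrA.
have E : a * a + b * b = 4 *r: 1 + (k * k) * (k * k).
  rewrite /a /b mulrBl !mulrBr -!scalerAl -!scalerAr !(mul1r, mulr1) !rscaleA.
  have -> : (2 * 2 : R) = 4 by ring.
  have -> : 4 *r: (k * k) = 2 *r: (k * k) + 2 *r: (k * k).
    by rewrite -rscaleDl; congr (_%:C%C *: _); ring.
  by rewrite opprB addrACA !subrK.
have le1 : N (a * a) <= 4 + N k ^+ 4.
  apply: le_trans (unorm_sq_le_add sa sb ab) _; rewrite E.
  apply: le_trans (unormD _ _) _; apply: lerD.
    by rewrite unormZp//; have := unorm1 U; lra.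
  rewrite (unorm_sq (selfadjointM _ sk sk))// (unorm_sq sk).
  by rewrite -exprM.
have le2 : N a ^+ 2 <= (2 + N k ^+ 4 / 4) ^+ 2.
  rewrite -unorm_sq//; apply: le_trans le1 _.
  have := exprn_ge0 4 (unorm_ge0 k); nra.
have k4 : 0 <= N k ^+ 4 by rewrite exprn_ge0// unorm_ge0.
by move: le2; rewrite ler_pXn2r ?nnegrE ?unorm_ge0//; lra.
Qed.

Lemma positive_sq k : selfadjoint k -> positive (k * k).
Proof.
move=> sk e e0; set K := N k ^+ 4.
have K0 : 0 <= K by rewrite exprn_ge0 ?unorm_ge0.
pose s := e / (1 + K); have s0 : 0 < s by rewrite divr_gt0// ltr_pwDl.
(* The previous lemma for [t k] bounds [|1 - s k^2|] by [1 + s^2 K / 2]. *)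
pose t := Num.sqrt (2 * s).
have t2 : t * t = 2 * s by rewrite -expr2 sqr_sqrtr// mulr_ge0// ltW.
exists s => //; have := unorm_sub_sq (selfadjointZ t sk).
have -> : 2 *r: 1 - (t *r: k) * (t *r: k) = 2 *r: (1 + s *r: (- (k * k))).
  by rewrite -scalerAl -scalerAr rscaleA t2 scalerDr rscaleA scalerN.
rewrite !unormZp ?sqrtr_ge0// exprMn -/K.
have -> : t ^+ 4 = 4 * s ^+ 2.
  by rewrite -[4%N]/(2 * 2)%N exprM [t ^+ 2]expr2 t2 exprMn; ring.
have sK : s * K <= e.
  rewrite /s mulrAC ler_pdivrMr ?ltr_pwDl// mulrDr mulr1; lra.
move: (ler_wpM2l (ltW s0) sK); rewrite mulrA -expr2.
by have := mulr_ge0 (ltW s0) (ltW e0); lra.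
Qed.

End CStarSeminormedTheory.

(** * Positive elements *)

Section PositiveElements.
Variables (R : realType) (U : cstarSeminormed R).
Implicit Types (x y a b h k p q : U) (r s t e : R).
Local Notation N := (@unorm R U).
Local Notation "x ^#" := (ustar x).

(** The iteration [y |-> (x + y^2) / 2] approximates [1 - sqrt (1 - x)]; its error
    [x - 2 y + y^2] is multiplied by at most [r] at each step. *)
Lemma sqrt_iteration x r n : selfadjoint x -> 0 <= r -> r < 1 -> N x <= r ->
  exists y, [/\ selfadjoint y, forall b, x * b = b * x -> y * b = b * y,
    N y <= r & N (x - 2 *r: y + y * y) <= r ^+ n].
Proof.
move=> sx r0 r1 xr; elim: n => [|n [y [sy yc yr err]]].
  exists 0; split=> //.
  - exact: ustar0.
  - by move=> b _; rewrite mul0r mulr0.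
  - by rewrite unorm0.
  - by rewrite scaler0 mul0r subr0 addr0 (le_trans xr)// ltW.
have xy : y * x = x * y by exact: yc.
pose z := 2^-1 *r: (x + y * y).
have z2 : 2 *r: z = x + y * y by rewrite /z rscaleA mulfV// rscale1.
have zy : z * y = y * z.
  by rewrite /z -scalerAl -scalerAr mulrDl mulrDr xy mulrA.
exists z; split.
- apply: selfadjointZ; apply: selfadjointD => //.
  exact: selfadjointM.
- move=> b xb; rewrite /z -scalerAl -scalerAr mulrDl mulrDr xb.
  by rewrite -[y * y * b]mulrA (yc b)// [y * _]mulrA (yc b)// [b * (y * y)]mulrA.
- rewrite unormZp ?invr_ge0//. rewrite ler_pdivrMl//.
  apply: le_trans (unormD _ _) _.
  have := le_trans (unormM y y) (ler_pM (unorm_ge0 y) (unorm_ge0 y) yr yr).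
  nra.
- have -> : x - 2 *r: z + z * z = (z - y) * (z + y).
    rewrite z2 opprD addrA subrr sub0r mulrBl !mulrDr zy.
    by rewrite opprD addrA addrK addrC.
  have zyE : 2 *r: (z - y) = x - 2 *r: y + y * y.
    by rewrite scalerBr z2 addrAC.
  have e1 : 2 * N (z - y) <= r ^+ n by rewrite -unormZp// zyE.
  have zr : N z <= r.
    rewrite unormZp ?invr_ge0// ler_pdivrMl//.
    apply: le_trans (unormD _ _) _.
    have := le_trans (unormM y y) (ler_pM (unorm_ge0 y) (unorm_ge0 y) yr yr).
    nra.
  have e2 : N (z + y) <= 2 * r by have := unormD z y; lra.
  apply: le_trans (unormM _ _) _; rewrite exprSr.
  have := ler_pM (mulr_ge0 (ler0n _ 2) (unorm_ge0 (z - y))) (unorm_ge0 _) e1 e2.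
  lra.
Qed.

(** [p + 2 e'] is a multiple of [1 - x] with [|x| < 1] as soon as
    [|1 - s p| <= 1 + s e'], whence an approximate square root of [p]. *)
Lemma positive_sqrt p e : selfadjoint p -> positive p -> 0 < e ->
  exists q, [/\ selfadjoint q, forall b, p * b = b * p -> q * b = b * q &
    N (p - q * q) <= e].
Proof.
move=> sp pp e0; pose d := e / 4; have d0 : 0 < d by rewrite divr_gt0.
have [s s0] := pp d d0; rewrite add0r scalerN => Hs.
pose c := 1 + s * (2 * d).
have sd : 0 < s * d by rewrite mulr_gt0.
have c0 : 0 < c by rewrite /c; lra.
pose x := c^-1 *r: (1 - s *r: p).
pose r := (1 + s * d) / c.
have r0 : 0 <= r by rewrite divr_ge0 ?(ltW c0)//; lra.
have r1 : r < 1 by rewrite ltr_pdivrMr// mul1r /c; lra.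
have sx : selfadjoint x.
  apply: selfadjointZ; apply: selfadjointD; first exact: selfadjoint1.
  by apply: selfadjointN; exact: selfadjointZ.
have xr : N x <= r.
  by rewrite unormZp ?invr_ge0 ?(ltW c0)// /r mulrC ler_pM2r ?invr_gt0.
have ds0 : 0 < d * s / c by rewrite !divr_gt0// mulr_gt0.
have [n rn] := exists_expr_lt r0 r1 ds0.
have [y [sy yc _ err]] := sqrt_iteration n sx r0 r1 xr.
pose w := Num.sqrt (c / s).
have w2 : w * w = c / s by rewrite -expr2 sqr_sqrtr// divr_ge0 ?ltW.
exists (w *r: (1 - y)); split.
- apply: selfadjointZ; apply: selfadjointD; first exact: selfadjoint1.
  exact: selfadjointN.
- move=> b pb; rewrite -scalerAl -scalerAr mulrBl mulrBr mul1r mulr1 yc//.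
  by rewrite /x -scalerAl -scalerAr mulrBl mulrBr mul1r mulr1 -scalerAl -scalerAr pb.
- have -> : w *r: (1 - y) * (w *r: (1 - y)) = (c / s) *r: ((1 - y) * (1 - y)).
    by rewrite -scalerAl -scalerAr rscaleA w2.
  have -> : p - (c / s) *r: ((1 - y) * (1 - y)) =
      - ((c / s) *r: (x - 2 *r: y + y * y)) - (2 * d) *r: 1.
    have E : (1 - y) * (1 - y) = 1 - 2 *r: y + y * y.
      by rewrite rscale2 mulrBl !mulrBr mul1r mulr1 opprB opprD !addrA mul1r [RHS]addrAC.
    have -> : (1 - y) * (1 - y) = (x - 2 *r: y + y * y) + (1 - x).
      by rewrite E [RHS]addrC -[x - _ + _]addrA !addrA subrK.
    have cx : (c / s) *r: x = s^-1 *r: 1 - p.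
      rewrite /x rscaleA mulrAC mulfV ?gt_eqF// mul1r scalerBr rscaleA.
      by rewrite mulVf ?gt_eqF// rscale1.
    have c1 : (c / s) *r: 1 = s^-1 *r: 1 + (2 * d) *r: 1 :> U.
      by rewrite -rscaleDl /c; congr (_%:C%C *: _); field; rewrite gt_eqF.
    rewrite scalerDr [_ *r: (1 - x)]scalerBr cx c1.
    have -> : s^-1 *r: 1 + (2 * d) *r: 1 - (s^-1 *r: 1 - p) = p + (2 * d) *r: 1.
      by rewrite opprB addrC addrA subrK.
    by rewrite !opprD addrCA addNKr.
  apply: le_trans (unormB _ _) _; rewrite unormN !unormZp ?divr_ge0 ?ltW//; last first.
    by rewrite mulr_gt0.
  have h1 : c / s * N (x - 2 *r: y + y * y) <= d.
    rewrite -ler_pdivlMl ?divr_gt0// invf_div mulrC mulrA.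
    by apply: le_trans err _; rewrite ltW.
  have := ler_wpM2l (ltW d0) (unorm1 U); rewrite /d in h1 *; lra.
Qed.

(** An approximate square root [q] of [p] commutes with [k], so that [k p k] is close to
    the square of the selfadjoint element [q k]. *)
Lemma positive_sandwich_comm k p : selfadjoint k -> selfadjoint p ->
  p * k = k * p -> positive p -> positive (k * p * k).
Proof.
move=> sk sp pk pp; apply: positive_lim => e e0.
have k1 : 0 < 1 + N k * N k by rewrite ltr_pwDl// mulr_ge0 ?unorm_ge0.
have [q [sq qc err]] := positive_sqrt sp pp (divr_gt0 e0 k1).
have qk : q * k = k * q by exact: qc.
exists (q * k * (q * k)); first by apply: positive_sq; exact: selfadjointM.
have -> : k * p * k - q * k * (q * k) = k * (p - q * q) * k.
  by rewrite mulrBr mulrBl qk !mulrA -[k * q * k * q]mulrA -qk !mulrA.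
apply: le_trans (unormM _ _) _.
have h1 := le_trans (unormM k (p - q * q)) (ler_wpM2l (unorm_ge0 k) err).
apply: le_trans (ler_wpM2r (unorm_ge0 k) h1) _.
rewrite mulrAC mulrA ler_pdivrMr// [leRHS]mulrC.
by rewrite ler_pM2r//; lra.
Qed.

Lemma selfadjointX h n : selfadjoint h -> selfadjoint (h ^+ n).
Proof.
move=> sh; elim: n => [|n IH]; first exact: selfadjoint1.
by rewrite exprS; apply: selfadjointM => //; rewrite -exprS exprSr.
Qed.

Lemma unorm_expr_exp2 h (k : nat) : selfadjoint h -> N (h ^+ (2 ^ k)%N) = N h ^+ (2 ^ k)%N.
Proof.
move=> sh; elim: k => [|k IH]; first by rewrite expn0 !expr1.
by rewrite expnSr !exprM [in LHS]expr2 unorm_sq ?IH//; exact: selfadjointX.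
Qed.

(** The algebraic reason why [a b] and [b a] have the same nonzero spectrum. *)
Lemma expr_swap a b s n :
  (1 + s *r: (b * a)) ^+ n =
  1 + s *r: (b * (\sum_(i < n) (1 + s *r: (a * b)) ^+ i) * a).
Proof.
elim: n => [|n IH]; first by rewrite big_ord0 mulr0 mul0r scaler0 addr0.
rewrite exprS IH mulrDr mulr1 big_ord_recl expr0 -addrA; congr (_ + _).
have -> : \sum_(i < n) (1 + s *r: (a * b)) ^+ lift ord0 i =
    (1 + s *r: (a * b)) * \sum_(i < n) (1 + s *r: (a * b)) ^+ i.
  by rewrite mulr_sumr; apply: eq_bigr => i _; rewrite -exprS.
rewrite mulrDr mulr1 mulrDl scalerDr; congr (_ + _).
rewrite -scalerAr; congr (_ *: _); rewrite !mulrA; congr (_ * _ * _).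
by rewrite mulrDl mulrDr mul1r mulr1 -scalerAl -scalerAr mulrA.
Qed.

Lemma unorm_expr_le h r n : 1 <= r -> N h <= r -> N (h ^+ n) <= r ^+ n.
Proof.
move=> r1 hr; elim: n => [|n IH]; first by rewrite !expr0 unorm1.
rewrite !exprS; apply: le_trans (unormM _ _) _.
by rewrite ler_pM ?unorm_ge0.
Qed.

(** For a selfadjoint [h] the norm of [h^(2^k)] is the [2^k]-th power of the norm, and
    [expr_swap] bounds the powers of [1 + s a^* a] by those of [1 + s a a^*] up to a
    linear factor. *)
Lemma unorm_swap a s :
  N (1 + s *r: (a^# * a)) <= Num.max 1 (N (1 + s *r: (a * a^#))).
Proof.
set t := Num.max _ _.
have t1 : 1 <= t by rewrite le_max lexx.
have tN : N (1 + s *r: (a * a^#)) <= t by rewrite le_max lexx orbT.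
apply: (le_of_expr_exp2 (C := `|s| * (N a^# * N a)) t1 (unorm_ge0 _)) => k.
rewrite -unorm_expr_exp2; last first.
  apply: selfadjointD; first exact: selfadjoint1.
  by apply: selfadjointZ; exact: selfadjoint_starM.
rewrite expr_swap; set n := (2 ^ k)%N.
have S : N (\sum_(i < n) (1 + s *r: (a * a^#)) ^+ i) <= n%:R * t ^+ n.
  have bigN (m : nat) : N (\sum_(i < m) (1 + s *r: (a * a^#)) ^+ i) <=
      \sum_(i < m) N ((1 + s *r: (a * a^#)) ^+ i).
    elim: m => [|m IH]; first by rewrite !big_ord0 unorm0.
    by rewrite !big_ord_recr /=; apply: le_trans (unormD _ _) _; rewrite lerD2r.
  apply: le_trans (bigN n) _; rewrite mulr_natl -[X in _ *+ X]card_ord -sumr_const.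
  apply: ler_sum => i _; apply: le_trans (unorm_expr_le i t1 tN) _.
  by rewrite ler_weXn2l// ltnW.
apply: le_trans (unormD _ _) _; apply: lerD; first exact: unorm1.
rewrite unormZr -!mulrA ler_wpM2l//.
apply: le_trans (unormM _ _) _; rewrite mulrCA [leRHS]mulrC -!mulrA.
rewrite ler_wpM2l ?unorm_ge0//; apply: le_trans (unormM _ _) _.
by rewrite mulrA ler_wpM2r ?unorm_ge0.
Qed.

Lemma log_norm_swap a r : 0 <= r ->
  log_norm_le (a * a^#) r -> log_norm_le (a^# * a) r.
Proof.
move=> r0 ar e e0; have [s s0 Hs] := ar e e0; exists s => //.
apply: le_trans (unorm_swap _ _) _; rewrite ge_max Hs andbT lerDl.
by rewrite mulr_ge0 ?ltW// ltr_wpDl.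
Qed.

(** With [a = x + i y] this sum is [2 (x^2 + y^2)]. *)
Lemma positive_starM_add a : positive (a^# * a + a * a^#).
Proof.
have sx : selfadjoint (a + a^#) by rewrite /selfadjoint ustarD ustarK addrC.
have sy : selfadjoint ('i%C *: (a - a^#)).
  by rewrite /selfadjoint ustarZ conj_i ustarB ustarK scaleNr -scalerN opprB.
have := positiveD (positive_sq sx) (positive_sq sy).
have -> : (a + a^#) * (a + a^#) + 'i%C *: (a - a^#) * ('i%C *: (a - a^#)) =
    2 *r: (a^# * a + a * a^#).
  rewrite rscale2 -scalerAl -scalerAr scalerA mulii scaleN1r.
  rewrite mulrDl mulrBl !mulrDr !mulrN !opprD !opprK.
  rewrite [RHS]addrACA [RHS]addrC [LHS]addrACA; congr (_ + _).
    by rewrite addrACA subrr add0r.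
  by rewrite addrACA subrr addr0.
move/(positiveZ (r := 2^-1)); rewrite rscaleA mulVf// rscale1; apply.
by rewrite invr_gt0.
Qed.

(** Evaluation of a polynomial in one element reduces identities between
    elements of a commutative subalgebra to identities between polynomials. *)
Local Notation ev h := (horner_alg h).

Lemma evC h r : ev h (r%:C%C)%:P = r *r: 1.
Proof. exact: horner_algC. Qed.

(** On the interval from 0 to [3 t] the function [h (3 t - h)^2] is largest at [h = t],
    with value [4 t^3]; the right-hand side displays the defect as a square times
    a positive factor. *)
Lemma defect_upper h t :
  (4 * t ^+ 3) *r: 1 - ((3 * t) *r: 1 - h) * h * ((3 * t) *r: 1 - h) =
  (h - t *r: 1) * (t *r: 1 + ((3 * t) *r: 1 - h)) * (h - t *r: 1).
Proof.
rewrite -(horner_algX h) -!(evC h).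
rewrite -!(rmorphB, rmorphM, rmorphD)/=; congr (ev h _).
ring.
Qed.

(** For negative [h] the function [h (3 t - h)^2] lies below [9 t^2 h]; the difference is
    [h^2] times a positive factor. *)
Lemma defect_lower h t :
  ((3 * t) *r: 1 - h) * h * ((3 * t) *r: 1 - h) =
  (9 * t ^+ 2) *r: h - h * ((3 * t) *r: 1 + ((3 * t) *r: 1 - h)) * h.
Proof.
have -> : (9 * t ^+ 2) *r: h = (9 * t ^+ 2) *r: 1 * h by rewrite -scalerAl mul1r.
rewrite -(horner_algX h) -!(evC h).
rewrite -!(rmorphB, rmorphM, rmorphD)/=; congr (ev h _).
ring.
Qed.

Lemma positive_const r : 0 <= r -> positive (r *r: 1 : U).
Proof.
move=> r0; have := log_norm_le_const U (- r).
by rewrite rmorphN scaleNr; apply: log_norm_leW; rewrite oppr_le0.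
Qed.

Lemma selfadjoint_const r : selfadjoint (r *r: 1 : U).
Proof. by apply: selfadjointZ; exact: selfadjoint1. Qed.

Lemma const_comm r h : (r *r: 1) * h = h * (r *r: 1).
Proof. by rewrite -scalerAl -scalerAr mul1r mulr1. Qed.

(** The negative part of each [a^* a] is at most [r] times its positive part. *)
Definition defect_ratio r := forall a s, 0 < s ->
  log_norm_le (a^# * a) s -> log_norm_le (- (a^# * a)) (r * s).

(** The positive part of [a a^*] is that of [a^* a], and it bounds the negative part of
    [a^* a] because [a^* a + a a^*] is positive. *)
Lemma defect_ratio1 : defect_ratio 1.
Proof.
move=> a s s0 as_; have := positive_starM_add a.
have := @log_norm_swap a^# s (ltW s0); rewrite ustarK => /(_ as_) h1 h2.
have := log_norm_leD h1 h2; rewrite addr0 mul1r.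
by rewrite opprD addrCA subrr addr0.
Qed.

(** Passing from [a] to [a w] with [w = s - a^* a] turns [h = a^* a] into [h w^2].  This
    lowers the upper bound from [s] to [4 s^3 / 27], while the negative part is
    multiplied by at least [s^2]. *)
Lemma defect_ratio_contract r : defect_ratio r -> defect_ratio (r * (4 / 27)).
Proof.
move=> hr a s s0 as_; set h := a^# * a.
have sh : selfadjoint h by exact: selfadjoint_starM.
pose t := s / 3; have t0 : 0 < t by rewrite divr_gt0.
have st : s = 3 * t by rewrite /t; field.
pose w := (3 * t) *r: 1 - h : U.
have pw : positive w by rewrite /w -st; apply: (log_norm_le_positive _ _).1.
have sw : selfadjoint w.
  by apply: selfadjointD; [exact: selfadjoint_const | exact: selfadjointN].
have cE : (a * w)^# * (a * w) = w * h * w by rewrite ustarM sw /h !mulrA.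
have hw : h * w = w * h by rewrite /w mulrBl mulrBr const_comm.
have up : log_norm_le ((a * w)^# * (a * w)) (4 * t ^+ 3).
  apply: (log_norm_le_positive _ _).2; rewrite cE defect_upper -/w.
  apply: positive_sandwich_comm.
  - by apply: selfadjointD => //; apply: selfadjointN; exact: selfadjoint_const.
  - by apply: selfadjointD => //; exact: selfadjoint_const.
  - rewrite [LHS]mulrDl [RHS]mulrDr const_comm; congr (_ + _).
    by rewrite [LHS]mulrBr [RHS]mulrBl const_comm -hw.
  - by apply: positiveD => //; apply: positive_const; exact: ltW.
have t3 : 0 < 4 * t ^+ 3 by rewrite mulr_gt0 ?exprn_gt0.
have h1 := hr _ _ t3 up.
have h2 : positive (h * ((3 * t) *r: 1 + w) * h).
  apply: positive_sandwich_comm => //.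
  - by apply: selfadjointD => //; exact: selfadjoint_const.
  - by rewrite mulrDl mulrDr const_comm hw.
  - by apply: positiveD => //; apply: positive_const; rewrite mulr_ge0// ltW.
have := log_norm_leD h1 h2; rewrite cE defect_lower -/w addr0 -opprD subrK.
have t2 : 0 < 9 * t ^+ 2 by rewrite mulr_gt0 ?exprn_gt0.
move/(log_norm_leZ (c := (9 * t ^+ 2)^-1)); rewrite invr_gt0 => /(_ t2).
rewrite scalerN rscaleA mulVf ?gt_eqF// rscale1.
suff -> : (9 * t ^+ 2)^-1 * (r * (4 * t ^+ 3)) = r * (4 / 27) * s by [].
by rewrite st; field; rewrite gt_eqF.
Qed.

(** The contraction of the ratio can be repeated indefinitely, hence the ratio is 0. *)
Lemma positive_starM a : positive (a^# * a).
Proof.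
pose s := N (a^# * a) + 1.
have s0 : 0 < s by rewrite ltr_wpDl ?unorm_ge0.
have Hn (n : nat) : defect_ratio ((4 / 27) ^+ n).
  elim: n => [|n IH]; first by rewrite expr0; exact: defect_ratio1.
  by rewrite exprSr; exact: defect_ratio_contract.
apply: log_norm_le_lim => e e0.
have [||n Hne] := @exists_expr_lt R (4 / 27) (e / s) _ _ (divr_gt0 e0 s0); try lra.
apply: log_norm_leW (Hn n a s s0 _).
  by rewrite add0r -ler_pdivlMr// ltW.
by apply: log_norm_leW (log_norm_le_norm _); rewrite lerDl.
Qed.

(** An approximate square root [q] of [p] makes [x^* p x] close to [(q x)^* (q x)]. *)
Lemma positive_sandwich x p : selfadjoint p -> positive p ->
  positive (x^# * p * x).
Proof.
move=> sp pp; apply: positive_lim => e e0.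
have k1 : 0 < 1 + N x * N x by rewrite ltr_pwDl// mulr_ge0 ?unorm_ge0.
have [q [sq _ err]] := positive_sqrt sp pp (divr_gt0 e0 k1).
exists ((q * x)^# * (q * x)); first exact: positive_starM.
have -> : x^# * p * x - (q * x)^# * (q * x) = x^# * (p - q * q) * x.
  by rewrite ustarM sq mulrBr mulrBl !mulrA.
apply: le_trans (unormM _ _) _.
have h1 := le_trans (unormM x^# (p - q * q)) (ler_wpM2l (unorm_ge0 _) err).
apply: le_trans (ler_wpM2r (unorm_ge0 x) h1) _.
rewrite unormS mulrAC mulrA ler_pdivrMr// [leRHS]mulrC.
by rewrite ler_pM2r//; lra.
Qed.

(** If [p = q1^2] and [r - p = q2^2] then [|q1^2| <= |q1^2 + q2^2| = r], up to errors. *)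
Lemma unorm_le_of_positive p r : selfadjoint p -> 0 <= r ->
  positive p -> positive (r *r: 1 - p) -> N p <= r.
Proof.
move=> sp r0 pp rp; apply/ler_addgt0Pr => e e0.
have d0 : 0 < e / 3 by rewrite divr_gt0.
have [q [sq qc qe]] := positive_sqrt sp pp d0.
have sr : selfadjoint (r *r: 1 - p).
  by apply: selfadjointD; [exact: selfadjoint_const | exact: selfadjointN].
have [k [sk kc ke]] := positive_sqrt sr rp d0.
have qp : q * p = p * q by exact: qc.
have kq : q * k = k * q.
  by apply/esym/kc; rewrite mulrBl mulrBr const_comm qp.
have h1 := unorm_sq_le_add sq sk kq.
have h2 : N (q * q + k * k) <= r + e / 3 + e / 3.
  have -> : q * q + k * k = r *r: 1 - (p - q * q) - (r *r: 1 - p - k * k).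
    have -> : r *r: 1 - (p - q * q) = (r *r: 1 - p) + q * q.
      by rewrite opprB addrCA addrC.
    by rewrite opprB [RHS]addrC addrA subrK addrC.
  apply: le_trans (unormB _ _) _; apply: lerD => //.
  apply: le_trans (unormB _ _) _; apply: lerD => //.
  by rewrite unormZp//; have := ler_wpM2l r0 (unorm1 U); rewrite mulr1.
have := unormD (p - q * q) (q * q); rewrite subrK; lra.
Qed.

(** Let [A], [B], [c] be the sums of [a_i^* a_i], [b_i^* b_i], [b_i^* a_i].  The sum of
    [(b_i c - t a_i)^* (b_i c - t a_i)] is positive, that is,
    [c^* B c - 2 t c^* c + t^2 A >= 0].  For [t > |B|] this gives [c^* c <= t A], and hence
    [|c|^2 <= t |A|]. *)
Lemma unorm_cauchy_schwarz (l : seq (U * U)) :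
  2 * N (\sum_(i <- l) i.2^# * i.1) <=
  N (\sum_(i <- l) i.1^# * i.1) + N (\sum_(i <- l) i.2^# * i.2).
Proof.
set c := \sum_(i <- l) _; set A := \sum_(i <- l) _; set B := \sum_(i <- l) _.
have sumP (F : U * U -> U) : positive (\sum_(i <- l) (F i)^# * F i).
  elim: l {c A B} => [|i l IH].
    by rewrite big_nil -[0](rscale0 1); exact: positive_const.
  by rewrite big_cons; apply: positiveD => //; exact: positive_starM.
have sA : selfadjoint A.
  by rewrite /selfadjoint ustar_sum; apply: eq_bigr => i _; rewrite ustarM ustarK.
have sB : selfadjoint B.
  by rewrite /selfadjoint ustar_sum; apply: eq_bigr => i _; rewrite ustarM ustarK.
apply/ler_addgt0Pr => e e0; pose t := N B + e.
have t0 : 0 < t by rewrite ltr_wpDl ?unorm_ge0.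
have t2 : (2 * t) *r: (c^# * c) = t *r: (c^# * c) + t *r: (c^# * c).
  by rewrite -rscaleDl; congr (_%:C%C *: _); ring.
have h1 : positive (c^# * (B * c) - (2 * t) *r: (c^# * c) + (t ^+ 2) *r: A).
  have := sumP (fun i => i.2 * c - t *r: i.1).
  rewrite (_ : \sum_(i <- l) _ = c^# * (B * c) - (2 * t) *r: (c^# * c) + t ^+ 2 *r: A) //.
  have cE : c^# = \sum_(i <- l) i.1^# * i.2.
    by rewrite ustar_sum; apply: eq_bigr => i _; rewrite ustarM ustarK.
  transitivity (\sum_(i <- l) (c^# * (i.2^# * i.2 * c)
      - (t *r: (c^# * (i.2^# * i.1)) + t *r: (i.1^# * i.2 * c))
      + t ^+ 2 *r: (i.1^# * i.1))).
    apply: eq_bigr => i _; rewrite ustarB ustarM ustarZr.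
    rewrite mulrBl !mulrBr -!scalerAl -!scalerAr rscaleA -expr2 !mulrA.
    by rewrite opprB opprD !addrA [LHS]addrAC.
  rewrite !big_split/= sumrN big_split/= -!scaler_sumr -!mulr_sumr -!mulr_suml.
  by rewrite -cE t2.
have h2 : positive (c^# * (t *r: 1 - B) * c).
  apply: positive_sandwich.
    by apply: selfadjointD; [exact: selfadjoint_const | exact: selfadjointN].
  apply: (log_norm_le_positive _ _).1; apply: log_norm_leW (log_norm_le_norm B).
  by rewrite lerDl ltW.
have h3 : positive (c^# * c) by exact: positive_starM.
have h4 : positive ((N A * t) *r: 1 - c^# * c).
  have := positiveZ t0 (positive_norm_sub A).
  rewrite scalerBr rscaleA mulrC => h5.
  have := positiveD h1 h2.
  have -> : c^# * (B * c) - (2 * t) *r: (c^# * c) + t ^+ 2 *r: A +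
      c^# * (t *r: 1 - B) * c = t *r: (t *r: A - c^# * c).
    rewrite mulrBr mulrBl -scalerAr mulr1 -scalerAl -[c^# * B * c]mulrA t2.
    rewrite [LHS]addrC !addrA subrK opprD addrA subrr sub0r [LHS]addrC.
    by rewrite scalerBr rscaleA -expr2.
  move/(positiveZ (r := t^-1)); rewrite invr_gt0 => /(_ t0).
  rewrite rscaleA mulVf ?gt_eqF// rscale1 => h6.
  by have := positiveD h5 h6; rewrite addrA subrK.
have h5 : N (c^# * c) <= N A * t.
  apply: unorm_le_of_positive => //; first exact: selfadjoint_starM.
  by rewrite mulr_ge0 ?unorm_ge0// ltW.
rewrite unorm_star in h5.
have -> : N A + N B + e = N A + t by rewrite /t addrA.
have NA := unorm_ge0 A.
have h6 : (2 * N c) ^+ 2 <= (N A + t) ^+ 2 by have := sqr_ge0 (N A - t); nra.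
by move: h6; rewrite ler_pXn2r ?nnegrE ?mulr_ge0 ?addr_ge0 ?unorm_ge0// ltW.
Qed.

End PositiveElements.

(** * Semi-inner products *)

(** The real part of a positive semidefinite sesquilinear form on a complex space.  It
    determines the form, and [formZ] expresses sesquilinearity. *)
Record semiInner (R : realType) (V : lmodType R[i]) := SemiInner {
  form :> V -> V -> R ;
  formDl : forall v v' w, form (v + v') w = form v w + form v' w ;
  formZr : forall (r : R) v w, form (r *r: v) w = r * form v w ;
  formZ : forall (z : R[i]) v w, form (z *: v) w = form v (Num.conj z *: w) ;
  formC : forall v w, form v w = form w v ;
  form_ge0 : forall v, 0 <= form v v
}.

Section SemiInnerTheory.
Variables (R : realType) (V : lmodType R[i]) (t : semiInner V).
Implicit Types (v w : V) (r : R).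

Lemma formDr v w w' : t v (w + w') = t v w + t v w'.
Proof. by rewrite formC formDl !(formC _ _ v). Qed.

Lemma formZrr r v w : t v (r *r: w) = r * t v w.
Proof. by rewrite formC formZr formC. Qed.

Lemma form_linear v : real_linear (t v).
Proof. by split=> [w w'|r w]; rewrite ?formDr ?formZrr. Qed.

Lemma formNl v w : t (- v) w = - t v w.
Proof. by rewrite formC (real_linearN _ (form_linear w)) formC. Qed.

Lemma form0l w : t 0 w = 0.
Proof. by rewrite formC (real_linear0 (form_linear w)). Qed.

Lemma form_cauchy_schwarz v w : t v w ^+ 2 <= t v v * t w w.
Proof.
have H r : 0 <= t v v + 2 * r * t v w + r ^+ 2 * t w w.
  have := form_ge0 t (v + r *r: w).
  by rewrite !formDl !formDr !formZr !formZrr (formC t w v); lra.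
have [w0|w0] := eqVneq (t w w) 0; last first.
  have wp : 0 < t w w by rewrite lt_neqAle eq_sym w0 form_ge0.
  have := H (- t v w / t w w).
  have -> : t v v + 2 * (- t v w / t w w) * t v w + (- t v w / t w w) ^+ 2 * t w w
     = t v v - t v w ^+ 2 / t w w by field.
  by rewrite subr_ge0 ler_pdivrMr.
rewrite w0 mulr0; have [-> |vw] := eqVneq (t v w) 0; first by rewrite expr0n.
have := H (- (t v v + 1) / t v w); rewrite w0 mulr0 addr0.
have -> : t v v + 2 * (- (t v v + 1) / t v w) * t v w = - t v v - 2 by field.
by have := form_ge0 t v; lra.
Qed.

Lemma form_scale (z : R[i]) v :
  t (z *: v) (z *: v) = complex.Re `|z| ^+ 2 * t v v.
Proof.
rewrite formZ scalerA.
have -> : Num.conj z * z = (complex.Re `|z| ^+ 2)%:C%C.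
  by rewrite mulrC -normCK rmorphXn; congr (_ ^+ 2); rewrite Re_normE.
by rewrite formZrr.
Qed.

Lemma seminorm_triangle v w :
  Num.sqrt (t (v + w) (v + w)) <= Num.sqrt (t v v) + Num.sqrt (t w w).
Proof.
have sv := sqrtr_ge0 (t v v); have sw := sqrtr_ge0 (t w w).
rewrite -ler_sqr ?nnegrE ?addr_ge0 ?sqrtr_ge0// sqr_sqrtr ?form_ge0//.
rewrite formDl !formDr (formC t w v).
have vv : Num.sqrt (t v v) ^+ 2 = t v v by rewrite sqr_sqrtr ?form_ge0.
have ww : Num.sqrt (t w w) ^+ 2 = t w w by rewrite sqr_sqrtr ?form_ge0.
have h : t v w <= Num.sqrt (t v v) * Num.sqrt (t w w).
  apply: le_trans (ler_norm _) _; rewrite -ler_sqr ?nnegrE ?mulr_ge0//.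
  by rewrite real_normK ?num_real// exprMn vv ww form_cauchy_schwarz.
rewrite sqrrD vv ww; lra.
Qed.

End SemiInnerTheory.

(** * Domination of a functional by positive functionals *)

Section Domination.
Variables (R : realType) (U : cstarSeminormed R).
Implicit Types (x y a b c : U) (r s t e : R).
Local Notation N := (@unorm R U).
Local Notation "x ^#" := (ustar x).

Variables (u : U -> R) (ulin : real_linear u) (uN : forall x, u x <= N x).

Let value (z : U * U) (l : seq (U * U)) : R :=
  N (z.1 + \sum_(i <- l) i.1^# * i.1) + N (z.2 + \sum_(i <- l) i.2^# * i.2)
  - 2 * u (\sum_(i <- l) i.2^# * i.1).

(** A linear functional below this gauge dominates [u] on every pair [(a, b)], and the
    gauge is finite because lists, not only single pairs, satisfy Cauchy-Schwarz. *)
Let gauge (z : U * U) : R := inf [set value z l | l in [set: seq (U * U)]].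

(** This is where [unorm_cauchy_schwarz] enters: the infimum defining the gauge is finite. *)
Lemma value_ge z l : - (N z.1 + N z.2) <= value z l.
Proof.
rewrite /value; set A := \sum_(i <- l) _; set B := \sum_(i <- l) _.
set c := \sum_(i <- l) _.
have := unormB (z.1 + A) z.1; rewrite [z.1 + A]addrC addrK.
have := unormB (z.2 + B) z.2; rewrite [z.2 + B]addrC addrK.
have := unorm_cauchy_schwarz l; rewrite -/A -/B -/c.
have := uN c; lra.
Qed.

Lemma gauge_le z l : gauge z <= value z l.
Proof.
apply: ge_inf; last by exists l.
by exists (- (N z.1 + N z.2)) => _ [k _ <-]; exact: value_ge.
Qed.

Lemma gauge_ge z m : (forall l, m <= value z l) -> m <= gauge z.
Proof.
move=> h; apply: lb_le_inf; first by exists (value z [::]); exists [::].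
by move=> _ [l _ <-].
Qed.

(** Lists are concatenated for the sum, and scaled by a square root for multiples. *)
Lemma gauge_sublinear : sublinear gauge.
Proof.
apply: sublinear_intro.
- move=> y z; rewrite -lerBlDr; apply: gauge_ge => l.
  rewrite lerBlDr -lerBlDl; apply: gauge_ge => k; rewrite lerBlDl.
  apply: le_trans (gauge_le _ (l ++ k)) _; rewrite /value !big_cat /= ulin.1.
  rewrite [y.1 + z.1 + _]addrACA [y.2 + z.2 + _]addrACA.
  set A := y.1 + _; set B := z.1 + _; set C := y.2 + _; set D := z.2 + _.
  have := unormD A B; have := unormD C D; lra.
- apply: le_trans (gauge_le _ [::]) _; rewrite /value !big_nil !addr0 /=.
  by rewrite unorm0 (real_linear0 ulin) mulr0 subr0 addr0.
- move=> r z r0; rewrite -ler_pdivrMl//; apply: gauge_ge => l.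
  rewrite ler_pdivrMl//; pose q := Num.sqrt r.
  have qq : q * q = r by rewrite -expr2 sqr_sqrtr// ltW.
  apply: le_trans (gauge_le _ [seq (q *r: i.1, q *r: i.2) | i <- l]) _.
  have E (F G : U * U -> U) : \sum_(i <- l) (q *r: F i)^# * (q *r: G i) =
      r *r: \sum_(i <- l) (F i)^# * G i.
    rewrite scaler_sumr; apply: eq_bigr => i _.
    by rewrite ustarZr -scalerAl -scalerAr rscaleA qq.
  rewrite /value !big_map /= !E -!scalerDr !unormZp ?(ltW r0)// ulin.2.
  lra.
Qed.

(** A linear functional below the gauge is at most the norm, by the empty list, and
    satisfies the domination inequality, by a list of length one.  Averaging it with
    its composition with the involution makes it hermitian. *)
Lemma exists_dominating : exists g1 g2 : U -> R,
  [/\ real_linear g1 /\ real_linear g2,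
      forall x, g1 x <= N x /\ g2 x <= N x,
      forall x, g1 x^# = g1 x /\ g2 x^# = g2 x &
      forall a b, 2 * u (b^# * a) <= g1 (a^# * a) + g2 (b^# * b)].
Proof.
have [g [glin gle _]] := hahn_banach 0 gauge_sublinear.
have g0 z : g z <= N z.1 + N z.2.
  apply: le_trans (gle z) (le_trans (gauge_le z [::]) _).
  by rewrite /value !big_nil !addr0 (real_linear0 ulin) mulr0 subr0.
have gsum a b : 2 * u (b^# * a) <= g (a^# * a, b^# * b).
  have := le_trans (gle (- (a^# * a, b^# * b))) (gauge_le _ [:: (a, b)]).
  rewrite /value !big_seq1 /= !addNr !unorm0 (real_linearN _ glin); lra.
have gE x y : g (x, y) = g (x, 0) + g (0, y).
  by rewrite -glin.1; congr g; congr (_, _); rewrite /= (addr0, add0r).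
pose g1 x := 2^-1 * (g (x, 0) + g (x^#, 0)).
pose g2 x := 2^-1 * (g (0, x) + g (0, x^#)).
have lin1 x y : g (x + y, 0) = g (x, 0) + g (y, 0).
  by rewrite -glin.1; congr g; congr (_, _); rewrite /= addr0.
have lin2 x y : g (0, x + y) = g (0, x) + g (0, y).
  by rewrite -glin.1; congr g; congr (_, _); rewrite /= addr0.
have linZ1 r x : g (r *r: x, 0) = r * g (x, 0).
  by rewrite -glin.2; congr g; congr (_, _); rewrite /= scaler0.
have linZ2 r x : g (0, r *r: x) = r * g (0, x).
  by rewrite -glin.2; congr g; congr (_, _); rewrite /= scaler0.
exists g1, g2; split.
- split; split=> [x y|r x]; rewrite /g1 /g2 ?ustarD ?ustarZr ?lin1 ?lin2 ?linZ1 ?linZ2; lra.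
- move=> x; rewrite /g1 /g2.
  have := g0 (x, 0); have := g0 (x^#, 0); have := g0 (0, x); have := g0 (0, x^#).
  by rewrite /= !unormS unorm0; split; lra.
- by move=> x; rewrite /g1 /g2 ustarK; split; rewrite [g _ + _]addrC.
- move=> a b; have := gsum a b; rewrite gE /g1 /g2 !ustarM !ustarK; lra.
Qed.

Variables (g1 g2 : U -> R).
Hypotheses (g1lin : real_linear g1) (g2lin : real_linear g2)
  (g1S : forall x, g1 x^# = g1 x) (g2S : forall x, g2 x^# = g2 x)
  (g1N : forall x, g1 x <= N x) (g2N : forall x, g2 x <= N x)
  (gu : forall a b, 2 * u (b^# * a) <= g1 (a^# * a) + g2 (b^# * b)).

(** The real part of the form given by the matrix with diagonal entries [g1], [g2] and
    off-diagonal entries [u]. *)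
Definition gram (v w : U * U) : R :=
  g1 (w.1^# * v.1) + g2 (w.2^# * v.2) + u (w.2^# * v.1) + u (v.2^# * w.1).

Lemma gramC v w : gram v w = gram w v.
Proof.
rewrite /gram -[g1 (w.1^# * _)]g1S -[g2 (w.2^# * _)]g2S !ustarM !ustarK.
by rewrite addrAC.
Qed.

Lemma gramDl v v' w : gram (v + v') w = gram v w + gram v' w.
Proof.
by rewrite /gram /= ustarD !mulrDr mulrDl !(g1lin.1, g2lin.1, ulin.1); lra.
Qed.

Lemma gramZr (r : R) v w : gram (r *r: v) w = r * gram v w.
Proof.
by rewrite /gram /= ustarZr -!scalerAr -!scalerAl !(g1lin.2, g2lin.2, ulin.2); lra.
Qed.

Lemma gramZ (z : R[i]) v w : gram (z *: v) w = gram v (Num.conj z *: w).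
Proof.
by rewrite /gram /= !ustarZ conjCK -!scalerAr -!scalerAl.
Qed.

(** The domination inequality at [(- v.1, v.2)]. *)
Lemma gram_ge0 v : 0 <= gram v v.
Proof.
have := gu (- v.1) v.2.
rewrite /gram !(mulrN, mulNr) ustarN mulNr opprK (real_linearN _ ulin); lra.
Qed.

Definition gram_form := SemiInner gramDl gramZr gramZ gramC gram_ge0.

Definition lmul c (v : U * U) : U * U := (c * v.1, c * v.2).

Lemma gram_lmul c v w : gram (lmul c v) w = gram v (lmul c^# w).
Proof. by rewrite /gram /= !ustarM ustarK !mulrA. Qed.

Lemma gram10 : gram (1, 0) (1, 0) = g1 1.
Proof.
rewrite /gram /= ustar1 ustar0 !mul1r !mul0r.
by rewrite (real_linear0 g2lin) (real_linear0 ulin) !addr0.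
Qed.

Lemma gram01 : gram (0, 1) (0, 1) = g2 1.
Proof.
rewrite /gram /= ustar1 ustar0 !mul1r !mul0r.
by rewrite (real_linear0 g1lin) (real_linear0 ulin) !addr0 add0r.
Qed.

Lemma gram_cross x : gram (0, 1) (x, 0) = u x.
Proof.
rewrite /gram /= !mulr0 ustar0 ustar1 mul0r mul1r.
by rewrite (real_linear0 g1lin) (real_linear0 g2lin) (real_linear0 ulin) !add0r.
Qed.

Lemma gram_lmulD c d v w :
  gram (lmul (c + d) v) w = gram (lmul c v) w + gram (lmul d v) w.
Proof. by rewrite -gramDl /lmul !mulrDl. Qed.

Lemma gram_lmulZ r c v w : gram (lmul (r *r: c) v) w = r * gram (lmul c v) w.
Proof. by rewrite -gramZr /lmul -!scalerAl. Qed.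

Lemma gram_lmul_norm c v :
  gram (lmul c v) v <= N c * (N v.1 + N v.2) ^+ 2.
Proof.
have le3 x y : N (x^# * (c * y)) <= N x * (N c * N y).
  apply: le_trans (unormM _ _) _; rewrite unormS ler_wpM2l ?unorm_ge0//.
  exact: unormM.
rewrite /gram /= ustarM -mulrA.
have h1 := le_trans (g1N _) (le3 v.1 v.1).
have h2 := le_trans (g2N _) (le3 v.2 v.2).
have h3 := le_trans (uN _) (le3 v.2 v.1).
have h4 : u (v.2^# * (c^# * v.1)) <= N v.2 * (N c * N v.1).
  apply: le_trans (uN _) _; apply: le_trans (unormM _ _) _.
  by rewrite unormS ler_wpM2l ?unorm_ge0// -(unormS c) unormM.
lra.
Qed.

(** [|c|^2 - c^* c] is approximately a square [q^2], and [(q v, q v) >= 0]. *)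
Lemma gram_lmul_le c v : gram (lmul c v) (lmul c v) <= N c ^+ 2 * gram v v.
Proof.
set C := (N v.1 + N v.2) ^+ 2.
have C0 : 0 <= C by exact: sqr_ge0.
apply/ler_addgt0Pr => e e0.
have d0 : 0 < e / (1 + C) by rewrite divr_gt0// ltr_pwDl.
have sp : selfadjoint (N c ^+ 2 *r: 1 - c^# * c).
  apply: selfadjointD; first exact: selfadjoint_const.
  by apply: selfadjointN; exact: selfadjoint_starM.
have pp : positive (N c ^+ 2 *r: 1 - c^# * c).
  by rewrite -unorm_star; exact: positive_norm_sub.
have [q [sq _ qe]] := positive_sqrt sp pp d0.
set p := _ - _ in sp pp qe.
have E x : gram (lmul x v) (lmul x v) = gram (lmul (x^# * x) v) v.
  by rewrite gram_lmul gramC /lmul /= !mulrA.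
have h1 := gram_ge0 (lmul q v); rewrite E sq in h1.
have h2 := gram_lmul_norm (q * q - p) v.
have h3 : N (q * q - p) * C <= e.
  rewrite unorm_distC; apply: le_trans (ler_wpM2r C0 qe) _.
  by rewrite mulrAC ler_pdivrMr ?ltr_pwDl// ler_wpM2l ?(ltW e0)//; lra.
have h4 : gram (lmul (c^# * c) v) v + gram (lmul p v) v = N c ^+ 2 * gram v v.
  by rewrite -gram_lmulD /p addrC subrK gram_lmulZ /lmul !mul1r -surjective_pairing.
have h5 : gram (lmul (q * q) v) v = gram (lmul (q * q - p) v) v + gram (lmul p v) v.
  by rewrite -gram_lmulD subrK.
rewrite E; rewrite -/C in h2; lra.
Qed.

End Domination.

(** * The Hilbert space of bounded functionals *)

Section DualSpace.
Variables (R : realType) (V : lmodType R[i]) (t : semiInner V).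
Implicit Types (v w : V) (r e M : R).

Definition bounded_functional (u : V -> R) : Prop :=
  real_linear u /\ exists M, forall v, u v ^+ 2 <= M * t v v.

Definition dual_pred : {pred V -> R} := fun u => `[< bounded_functional u >].

Lemma dual_zmod_closed : zmod_closed dual_pred.
Proof.
split; first by apply/asboolP; split; [split=> *; rewrite ?addr0 ?mulr0|
  exists 0 => v; rewrite expr0n mul0r].
move=> f g /asboolP[flin [M fM]] /asboolP[glin [K gK]]; apply/asboolP; split.
  split=> [v w|r v]; rewrite !fctE ?flin.1 ?glin.1 ?flin.2 ?glin.2; lra.
exists (2 * (M + K)) => v; rewrite !fctE.
by have := fM v; have := gK v; have := sqr_ge0 (f v + g v); lra.
Qed.

HB.instance Definition _ := GRing.isZmodClosed.Build (V -> R) dual_pred dual_zmod_closed.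

(** The Hilbert space completion of [V], realised by the Riesz theorem as the space of
    bounded antilinear functionals: neither a quotient nor Cauchy sequences are needed.
    An antilinear functional is determined by its real part [u], and multiplication by
    [z] turns [u] into its composition with multiplication by the conjugate of [z]. *)
Record dual := Dual { dual_val :> V -> R ; dual_valP : dual_val \in dual_pred }.
HB.instance Definition _ := [isSub for dual_val].
HB.instance Definition _ := [Choice of dual by <:].
HB.instance Definition _ := [SubChoice_isSubZmodule of dual by <:].

Implicit Types (u g h : dual).

Lemma dual_linear u : real_linear u.
Proof. by have /asboolP[] := dual_valP u. Qed.

Lemma dual_bounded u : exists2 M, 0 <= M & forall v, u v ^+ 2 <= M * t v v.
Proof.
have /asboolP[_ [M uM]] := dual_valP u; exists `|M| => // v.
by apply: le_trans (uM v) _; rewrite ler_wpM2r ?form_ge0// ler_norm.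
Qed.

Lemma dualP u g : (forall v, u v = g v) -> u = g.
Proof. by move=> ug; apply: val_inj; apply/funext. Qed.

Lemma dualDE u g v : (u + g) v = u v + g v. Proof. by []. Qed.
Lemma dualNE u v : (- u) v = - u v. Proof. by []. Qed.
Lemma dual_scale_subproof (z : R[i]) u :
  (fun v => u (Num.conj z *: v)) \in dual_pred.
Proof.
have ul := dual_linear u; have [M _ uM] := dual_bounded u.
apply/asboolP; split.
  split=> [v w|r v]; first by rewrite scalerDr ul.1.
  by rewrite scalerA mulrC -scalerA ul.2.
exists (M * complex.Re `|Num.conj z| ^+ 2) => v.
by apply: le_trans (uM _) _; rewrite form_scale mulrA.
Qed.

Definition dual_scale (z : R[i]) u : dual := Dual (dual_scale_subproof z u).

Lemma dual_scaleA (z y : R[i]) u : dual_scale z (dual_scale y u) = dual_scale (z * y) u.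
Proof. by apply: dualP => v /=; rewrite scalerA rmorphM mulrC. Qed.

Lemma dual_scale1 : left_id 1 dual_scale.
Proof. by move=> u; apply: dualP => v /=; rewrite rmorph1 scale1r. Qed.

Lemma dual_scaleDr : right_distributive dual_scale +%R.
Proof. by move=> z u g; apply: dualP. Qed.

Lemma dual_scaleDl u : {morph dual_scale^~ u : z y / z + y}.
Proof.
by move=> z y; apply: dualP => v /=; rewrite rmorphD scalerDl (dual_linear u).1.
Qed.

HB.instance Definition _ := GRing.Zmodule_isLmodule.Build R[i] dual
  dual_scaleA dual_scale1 dual_scaleDr dual_scaleDl.

Lemma dualZE (z : R[i]) u v : (z *: u) v = u (Num.conj z *: v). Proof. by []. Qed.

Lemma dualZrE r u v : (r *r: u) v = r * u v.
Proof. by rewrite dualZE conj_real (dual_linear u).2. Qed.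

Lemma riesz_subproof v : (t v : V -> R) \in dual_pred.
Proof.
apply/asboolP; split; first exact: form_linear.
by exists (t v v) => w; exact: form_cauchy_schwarz.
Qed.

(** The image of [v] in the completion. *)
Definition riesz v : dual := Dual (riesz_subproof v).

Lemma rieszD v w : riesz (v + w) = riesz v + riesz w.
Proof. by apply: dualP => x /=; rewrite formDl. Qed.

Lemma rieszZ (z : R[i]) v : riesz (z *: v) = z *: riesz v.
Proof. by apply: dualP => x /=; rewrite formZ. Qed.

Section Pairing.
Variable W : set V.
Hypothesis W0 : W 0.
Hypothesis WD : forall v w, W v -> W w -> W (v + w).
Hypothesis WZ : forall (z : R[i]) v, W v -> W (z *: v).

(** The restriction of [u] to [W] lies within [sqrt e] of the vector [w], in the
    completion of [W].  Completing an arbitrary submodule [W], and not only [V], is what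
    later yields orthogonal projections. *)
Definition approximates u w e :=
  W w /\ forall v, W v -> (u v - t w v) ^+ 2 <= e * t v v.

(** A near-maximiser [w] of the concave function sending [v] to [2 u v - t v v] on [W]
    represents [u] up to a small error, as comparison with [w + r v] shows. *)
Lemma approximates_exists u e : 0 < e -> exists w, approximates u w e.
Proof.
move=> e0; have ul := dual_linear u; have [M M0 uM] := dual_bounded u.
pose S := [set x | exists2 v, W v & x = 2 * u v - t v v].
have hS : has_sup S.
  split; first by exists (2 * u 0 - t 0 0), 0.
  exists M => _ [v Wv ->]; have := uM v; have := form_ge0 t v.
  move: (t v v) (u v) => T x T0 xT.
  have h : (2 * x) ^+ 2 <= (M + T) ^+ 2 by have := sqr_ge0 (M - T); lra.
  have : `|2 * x| <= `|M + T| by rewrite -ler_sqr ?nnegrE// !real_normK ?num_real.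
  by rewrite [`|M + T|]ger0_norm ?addr_ge0//; have := ler_norm (2 * x); lra.
have [_ [w Ww ->] Hw] := sup_adherent e0 hS.
exists w; split=> // v Wv.
have H r : 2 * r * (u v - t w v) - r ^+ 2 * t v v <= e.
  have : 2 * u (w + r *r: v) - t (w + r *r: v) (w + r *r: v) <= sup S.
    apply: sup_upper_bound => //; exists (w + r *r: v) => //.
    by apply: WD => //; exact: WZ.
  rewrite ul.1 ul.2 !formDl !formDr !formZr !formZrr (formC t v w); lra.
move: (_ - _) (form_ge0 t v) H => D; move: (t v v) => T.
rewrite le_eqVlt => /orP[/eqP<- H|T0 H].
  rewrite mulr0; have [->|D0] := eqVneq D 0; first by rewrite expr0n.
  have := H (e / D); rewrite mulr0 subr0.
  have -> : 2 * (e / D) * D = 2 * e by field.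
  lra.
have := H (D / T).
have -> : 2 * (D / T) * D - (D / T) ^+ 2 * T = D ^+ 2 / T by field; rewrite gt_eqF.
by rewrite ler_pdivrMr.
Qed.

(** The value [r] is the limit of [u w] as [w] tends to [g]; any constant [M] in the error
    bound suffices for uniqueness. *)
Definition is_pairing u g r := exists M, forall w e, 0 < e ->
  approximates g w e -> (u w - r) ^+ 2 <= M * e.

Lemma is_pairing_unique u g r r' : is_pairing u g r -> is_pairing u g r' -> r = r'.
Proof.
move=> [M hM] [K hK]; apply/eqP; rewrite -subr_eq0; apply/eqP.
apply: (@sq_small_eq0 _ _ (2 * (M + K))) => e e0 _.
have [w gw] := approximates_exists g e0.
have := hM w e e0 gw; have := hK w e e0 gw.
by have := sqr_ge0 (2 * u w - r - r'); lra.
Qed.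

Lemma approximates_dist u w w' e e' : 0 < e -> 0 < e' ->
  approximates u w e -> approximates u w' e' ->
  t (w - w') (w - w') <= 2 * (e + e').
Proof.
move=> e0 e'0 [Ww H] [Ww' H']; set d := w - w'.
have Wd : W d by rewrite /d -scaleN1r; apply: WD => //; exact: WZ.
have E : t d d = (u d - t w' d) - (u d - t w d).
  by rewrite {1}/d formDl formNl; lra.
have h := H d Wd; have h' := H' d Wd.
have d0 := form_ge0 t d.
have E2 : t d d * t d d <= 2 * (e + e') * t d d.
  rewrite [leLHS](_ : _ = ((u d - t w' d) - (u d - t w d)) ^+ 2); last by rewrite -E.
  have := sqr_ge0 ((u d - t w' d) + (u d - t w d)); lra.
have [d1|d1] := eqVneq (t d d) 0; last first.
  by rewrite -(ler_pM2r (x := t d d))// lt_neqAle eq_sym d1.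
by rewrite d1 mulr_ge0// addr_ge0// ltW.
Qed.

(** The intervals of radius [sqrt (2 M e)] around the values [u w], for [w] within [e] of
    [g], meet pairwise; hence they have a common point. *)
Lemma is_pairing_exists u g : exists r, is_pairing u g r.
Proof.
have ul := dual_linear u; have [M M0 uM] := dual_bounded u.
pose c e := Num.sqrt (2 * M * e).
have key w w' e e' : 0 < e -> 0 < e' -> approximates g w e -> approximates g w' e' ->
    u w - c e <= u w' + c e'.
  move=> e0 e'0 gw gw'.
  have := le_trans (uM (w - w')) (ler_wpM2l M0 (approximates_dist e0 e'0 gw gw')).
  rewrite ul.1 (real_linearN _ ul).
  have ce : c e * c e = 2 * M * e.
    by rewrite -expr2 sqr_sqrtr// !mulr_ge0// ltW.
  have ce' : c e' * c e' = 2 * M * e'.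
    by rewrite -expr2 sqr_sqrtr// !mulr_ge0// ltW.
  have c0 : 0 <= c e by exact: sqrtr_ge0.
  have c'0 : 0 <= c e' by exact: sqrtr_ge0.
  have := mulr_ge0 c0 c'0 => cc H.
  have h : (u w - u w') ^+ 2 <= (c e + c e') ^+ 2 by move: H; lra.
  have := ler_norm (u w - u w').
  have : `|u w - u w'| <= `|c e + c e'|.
    by rewrite -ler_sqr ?nnegrE// !real_normK ?num_real.
  by rewrite [`|c e + _|]ger0_norm ?addr_ge0//; lra.
pose S := [set x | exists w e, [/\ 0 < e, approximates g w e & x = u w - c e]].
have [w1 gw1] := approximates_exists g ltr01.
have hS : has_sup S.
  split; first by exists (u w1 - c 1), w1, 1.
  by exists (u w1 + c 1) => _ [w [e [e0 gw ->]]]; exact: key.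
exists (sup S), (2 * M) => w e e0 gw.
have h1 : u w - c e <= sup S by apply: sup_upper_bound => //; exists w, e.
have h2 : sup S <= u w + c e.
  apply: ge_sup; first exact: hS.1.
  by move=> _ [w' [e' [e'0 gw' ->]]]; exact: key.
have ce : c e * c e = 2 * M * e.
  by rewrite -expr2 sqr_sqrtr// !mulr_ge0// ltW.
rewrite -ce; move: h1 h2; move: (u w) (sup S) (c e) => x y z; nra.
Qed.

(** The real part of the inner product of the restrictions of [u] and [g] to [W], as
    elements of the completion of [W]. *)
Definition pairing u g : R := xget 0 [set r | is_pairing u g r].

Lemma pairingP u g : is_pairing u g (pairing u g).
Proof.
by rewrite /pairing; case: xgetP => [r _ //|none]; have [r /none] := is_pairing_exists u g.
Qed.

Lemma pairingE u g r : is_pairing u g r -> pairing u g = r.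
Proof. exact: is_pairing_unique (pairingP u g). Qed.

Lemma riesz_approximates w e : 0 < e -> W w -> approximates (riesz w) w e.
Proof.
move=> e0 Ww; split=> // v _ /=.
by rewrite subrr expr0n mulr_ge0 ?form_ge0// ltW.
Qed.

Lemma pairing_riesz u w : W w -> pairing u (riesz w) = u w.
Proof.
move=> Ww; have [M H] := pairingP u (riesz w).
apply/esym/eqP; rewrite -subr_eq0; apply/eqP/(@sq_small_eq0 _ _ M) => e e0 _.
by apply: H => //; exact: riesz_approximates.
Qed.

Lemma pairingDl u u' g : pairing (u + u') g = pairing u g + pairing u' g.
Proof.
have [M HM] := pairingP u g; have [K HK] := pairingP u' g.
apply: pairingE; exists (2 * (M + K)) => w e e0 gw.
have := HM w e e0 gw; have := HK w e e0 gw; rewrite dualDE.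
have := sqr_ge0 ((u w - pairing u g) - (u' w - pairing u' g)); lra.
Qed.

Lemma pairingZr (r : R) u g : pairing (r *r: u) g = r * pairing u g.
Proof.
have [M HM] := pairingP u g.
apply: pairingE; exists (r ^+ 2 * M) => w e e0 gw.
rewrite dualZrE -mulrBr exprMn -mulrA.
by rewrite ler_wpM2l ?sqr_ge0//; exact: HM.
Qed.

Lemma approximates_size g : exists K, forall w e, 0 < e -> e <= 1 ->
  approximates g w e -> t w w <= K.
Proof.
have [M M0 gM] := dual_bounded g; exists (2 * (1 + M)) => w e e0 e1 [Ww H].
have h1 := H w Ww; have h2 := gM w; have T0 := form_ge0 t w.
have : t w w * t w w <= 2 * (1 + M) * t w w.
  have := ler_wpM2r T0 e1; have := sqr_ge0 (g w + (g w - t w w)); lra.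
have [->|T1] := eqVneq (t w w) 0; first by rewrite mulr_ge0//; lra.
by rewrite ler_pM2r// lt_neqAle eq_sym T1.
Qed.

Lemma pairingC u g : pairing u g = pairing g u.
Proof.
have [M HM] := pairingP u g; have [M' HM'] := pairingP g u.
have [K HK] := approximates_size g; have [K' HK'] := approximates_size u.
apply/eqP; rewrite -subr_eq0; apply/eqP.
apply: (@sq_small_eq0 _ _ (4 * (M + M' + K + K'))) => e e0 e1.
have [w gw] := approximates_exists g e0; have [w' uw'] := approximates_exists u e0.
have h1 := HM w e e0 gw; have h2 := HM' w' e e0 uw'.
have h3 := le_trans (gw.2 w' uw'.1) (ler_wpM2l (ltW e0) (HK' w' e e0 e1 uw')).
have h4 := le_trans (uw'.2 w gw.1) (ler_wpM2l (ltW e0) (HK w e e0 e1 gw)).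
rewrite formC in h4.
move: h1 h2 h3 h4; move: (u w) (g w') (t w w') (pairing u g) (pairing g u).
move=> a b c r r' h1 h2 h3 h4.
have -> : r - r' = (- (a - r)) + (a - c) + (- (b - c)) + (b - r') by lra.
move: h1 h2 h3 h4; move: (a - r) (b - r') (b - c) (a - c) => x y z p.
have := sqr_ge0 (x + p); have := sqr_ge0 (x - z); have := sqr_ge0 (x + y).
have := sqr_ge0 (p + z); have := sqr_ge0 (p - y); have := sqr_ge0 (z + y).
lra.
Qed.

(** Adjoint linear maps of [V] act by composition on functionals, and these
    actions are adjoint to each other. *)
Lemma pairing_adjoint (S S' : V -> V) (K : R) u g u' g' :
  (forall w, W w -> W (S w)) -> (forall v, W v -> W (S' v)) ->
  (forall v w, t (S v) w = t v (S' w)) ->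
  (forall v, t (S' v) (S' v) <= K * t v v) ->
  (forall v, u' v = u (S v)) -> (forall v, g' v = g (S' v)) ->
  pairing u' g = pairing u g'.
Proof.
move=> WS WS' adj hK uE gE; have [M HM] := pairingP u g'.
pose L := Num.max 1 K; have L0 : 0 < L by rewrite lt_max ltr01.
apply: pairingE; exists (M * L) => w e e0 gw; rewrite uE -mulrA.
apply: HM; first exact: mulr_gt0.
split=> [|v Wv]; first by apply: WS; exact: gw.1.
rewrite gE adj; apply: le_trans (gw.2 _ (WS' _ Wv)) _.
rewrite [L * e]mulrC -mulrA ler_wpM2l ?(ltW e0)//.
apply: le_trans (hK v) _.
by rewrite ler_wpM2r ?form_ge0// le_max lexx orbT.
Qed.

Lemma pairingZ (z : R[i]) u g : pairing (z *: u) g = pairing u (Num.conj z *: g).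
Proof.
apply: (@pairing_adjoint (fun v => Num.conj z *: v) (fun v => z *: v)
  (complex.Re `|z| ^+ 2)) => //.
- by move=> w; exact: WZ.
- by move=> w; exact: WZ.
- by move=> v w; rewrite formZ conjCK.
- by move=> v; rewrite form_scale.
- by move=> v; rewrite dualZE conjCK.
Qed.

Lemma pairing_ge0 u : 0 <= pairing u u.
Proof.
have [M HM] := pairingP u u; have [K HK] := approximates_size u.
rewrite leNgt; apply/negP => r0.
suff r00 : pairing u u = 0 by rewrite r00 ltxx in r0.
apply: (@sq_small_eq0 _ _ (2 * (M + K))) => e e0 e1.
have [w gw] := approximates_exists u e0.
have h1 := HM w e e0 gw.
have h2 := le_trans (gw.2 w gw.1) (ler_wpM2l (ltW e0) (HK w e e0 e1 gw)).
have := form_ge0 t w; move: h1 h2 r0.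
move: (u w) (t w w) (pairing u u) => x T r h1 h2 r0 T0.
have := sqr_ge0 ((x - r) - (x - T) - 2 * (x - r)).
have : r ^+ 2 <= (T - r) ^+ 2 by nra.
lra.
Qed.

Definition pairing_form := SemiInner pairingDl pairingZr pairingZ pairingC pairing_ge0.

(** With [r] the pairing of [u] with itself, both [u w] and [t w w] tend to [r] as [w] approaches
    [u], so that [u w ^+ 2 <= M * t w w] becomes [r ^+ 2 <= M * r]. *)
Lemma pairing_le u M : 0 <= M -> (forall w, W w -> u w ^+ 2 <= M * t w w) ->
  pairing u u <= M.
Proof.
move=> M0 uM; have [L HL] := pairingP u u; have [K HK] := approximates_size u.
rewrite leNgt; apply/negP => rM; set r := pairing u u in rM HL.
suff x0 : r * (r - M) = 0.
  have : 0 < r * (r - M) by rewrite mulr_gt0 ?subr_gt0//; lra.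
  by rewrite x0 ltxx.
apply: (@sq_small_eq0 _ _ (8 * r ^+ 2 * L + 4 * M ^+ 2 * (L + K))) => e e0 e1.
have [w gw] := approximates_exists u e0.
have h1 := HL w e e0 gw.
have h2 := le_trans (gw.2 w gw.1) (ler_wpM2l (ltW e0) (HK w e e0 e1 gw)).
have h3 := uM w gw.1.
move: h1 h2 h3; move: (u w) (t w w) => x T h1 h2 h3.
have y0 : 0 <= r * (r - M) by rewrite mulr_ge0//; lra.
have y1 : r * (r - M) <= M * (T - r) - 2 * r * (x - r).
  by have := sqr_ge0 (x - r); lra.
have y2 : (r * (r - M)) ^+ 2 <= (M * (T - r) - 2 * r * (x - r)) ^+ 2.
  by rewrite ler_sqr ?nnegrE// (le_trans y0).
apply: le_trans y2 _.
have := sqr_ge0 (M * (T - r) + 2 * r * (x - r)).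
have := ler_wpM2l (sqr_ge0 M) h1; have := ler_wpM2l (sqr_ge0 M) h2.
have := ler_wpM2l (sqr_ge0 r) h1.
have := mulr_ge0 (sqr_ge0 M) (sqr_ge0 ((x - r) + (x - T))).
lra.
Qed.

End Pairing.

Lemma setT_closedD (v w : V) : [set: V] v -> [set: V] w -> [set: V] (v + w).
Proof. by []. Qed.

Lemma setT_closedZ (z : R[i]) (v : V) : [set: V] v -> [set: V] (z *: v).
Proof. by []. Qed.

Definition dual_form : semiInner dual :=
  pairing_form (I : [set: V] 0) setT_closedD setT_closedZ.

Lemma dual_form_riesz u v : dual_form u (riesz v) = u v.
Proof. exact: (pairing_riesz (I : [set: V] 0) setT_closedD setT_closedZ). Qed.

Lemma dual_form_eq0 u : dual_form u u = 0 -> u = 0.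
Proof.
move=> u0; apply: dualP => v; apply/eqP; rewrite -sqrf_eq0 eq_le sqr_ge0 andbT.
by have := form_cauchy_schwarz dual_form u (riesz v); rewrite u0 mul0r dual_form_riesz.
Qed.

Lemma dual_form_le u M : 0 <= M -> (forall w, u w ^+ 2 <= M * t w w) ->
  dual_form u u <= M.
Proof.
move=> M0 uM.
by apply: (pairing_le (I : [set: V] 0) setT_closedD setT_closedZ) => // w _.
Qed.

Definition dual_norm u : R[i] := (Num.sqrt (dual_form u u))%:C%C.

Lemma dual_normD u g : dual_norm (u + g) <= dual_norm u + dual_norm g.
Proof. by rewrite -rmorphD lecR; exact: seminorm_triangle. Qed.

Lemma dual_normZ (z : R[i]) u : dual_norm (z *: u) = `|z| * dual_norm u.
Proof.
rewrite /dual_norm form_scale sqrtrM ?sqr_ge0// sqrtr_sqr.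
by rewrite (ger0_norm (Re_norm_ge0 z)) rmorphM; congr (_ * _); exact: Re_normE.
Qed.

Lemma dual_norm0_eq0 u : dual_norm u = 0 -> u = 0.
Proof.
move=> /eqP; rewrite -[0](rmorph0 (real_complex R)) (inj_eq (fmorph_inj _)).
rewrite sqrtr_eq0 => u0; apply: dual_form_eq0; apply/eqP.
by rewrite eq_le u0 form_ge0.
Qed.

HB.instance Definition _ := Lmodule_isNormed.Build R[i] dual
  dual_normD dual_normZ dual_norm0_eq0.

End DualSpace.

Section DualHilbert.
Variables (R : realType) (V : lmodType R[i]) (t : semiInner V).
Local Notation H := (dual t).
Implicit Types (u g x : H) (v w : V).

Lemma dual_rnormE u : rnorm u = Num.sqrt (dual_form t u u).
Proof. by []. Qed.

Lemma dual_rnorm_sq u : rnorm u ^+ 2 = dual_form t u u.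
Proof. by rewrite dual_rnormE sqr_sqrtr ?form_ge0. Qed.

Lemma dual_eval_le u v : u v ^+ 2 <= rnorm u ^+ 2 * t v v.
Proof.
rewrite dual_rnorm_sq -(dual_form_riesz u v).
have -> : t v v = dual_form t (riesz t v) (riesz t v) by rewrite dual_form_riesz.
exact: form_cauchy_schwarz.
Qed.

Lemma dual_eval_norm u v : `|u v| <= rnorm u * Num.sqrt (t v v).
Proof.
rewrite -ler_sqr ?nnegrE ?mulr_ge0 ?sqrtr_ge0 ?rnorm_ge0//.
by rewrite real_normK ?num_real// exprMn (sqr_sqrtr (form_ge0 t v)) dual_eval_le.
Qed.

Lemma dual_rnorm_le u (M : R) : 0 <= M -> (forall v, u v ^+ 2 <= M ^+ 2 * t v v) ->
  rnorm u <= M.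
Proof.
move=> M0 uM; rewrite -ler_sqr ?nnegrE ?rnorm_ge0// dual_rnorm_sq.
by apply: dual_form_le => //; exact: sqr_ge0.
Qed.

Lemma dual_form_norm u x : `|dual_form t u x| <= rnorm u * rnorm x.
Proof.
rewrite -ler_sqr ?nnegrE ?mulr_ge0 ?rnorm_ge0// real_normK ?num_real//.
by rewrite exprMn !dual_rnorm_sq form_cauchy_schwarz.
Qed.

Lemma cauchy_rnorm (F : set_system H) : ProperFilter F -> cauchy F ->
  forall e : R, 0 < e -> exists x, \forall u \near F, rnorm (x - u) < e.
Proof.
move=> FF /cauchyP Fc e e0.
have e0' : 0 < e%:C%C :> R[i] by rewrite ltcR.
have [x xF] := Fc _ e0'; exists x; apply: filterS xF => u.
by rewrite -ball_normE /= rnorm_ltE.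
Qed.

(** A Cauchy filter converges pointwise, and the bound on the differences of values
    that holds near the filter passes to the pointwise limit. *)
Lemma dual_complete (F : set_system H) : ProperFilter F -> cauchy F -> cvg F.
Proof.
move=> FF Fc; have {}Fc := cauchy_rnorm FF Fc.
have evc v : cvg ((fun u : H => u v) @ F).
  apply/cauchy_cvgP/cauchyP => e e0.
  have s0 : 0 < 1 + Num.sqrt (t v v) by rewrite ltr_pwDl ?sqrtr_ge0.
  have [x xF] := Fc (e / (1 + Num.sqrt (t v v))) (divr_gt0 e0 s0).
  exists (x v); apply: filterS xF => u /= xu.
  rewrite -ball_normE /=; apply: le_lt_trans (dual_eval_norm (x - u) v) _.
  apply: (@le_lt_trans _ _ (rnorm (x - u) * (1 + Num.sqrt (t v v)))).
    by rewrite ler_wpM2l ?rnorm_ge0// lerDr.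
  by rewrite -ltr_pdivlMr.
pose f v := lim ((fun u : H => u v) @ F).
have fE v : (fun u : H => u v) @ F --> f v by exact: evc.
have f_lim v (l : R) : (fun u : H => u v) @ F --> l -> f v = l.
  by move=> h; rewrite /f; exact: (cvg_lim (@norm_hausdorff _ R) h).
have near_f (x : H) (e : R) v : (\forall u \near F, rnorm (x - u) < e) ->
    `|f v - x v| <= e * Num.sqrt (t v v).
  move=> xF; apply/ler_addgt0Pr => d d0.
  have /cvgrPdist_lt/(_ d d0) fF := fE v.
  have [u [fu xu]] := filter_ex (filterI fF xF).
  have -> : f v - x v = (f v - u v) - (x v - u v) by lra.
  apply: le_trans (ler_normB _ _) _; rewrite addrC; apply: lerD; last exact: ltW.
  apply: le_trans (dual_eval_norm (x - u) v) _.
  by rewrite ler_wpM2r ?sqrtr_ge0// ltW.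
have f_lin : real_linear f.
  split=> [v w|r v].
    apply: (f_lim).
    have -> : (fun u : H => u (v + w)) = (fun u : H => u v) \+ (fun u : H => u w).
      by apply/funext => u; rewrite (dual_linear u).1.
    exact: cvgD (fE v) (fE w).
  apply: (f_lim).
  have -> : (fun u : H => u (r *r: v)) = (fun u : H => r * u v).
    by apply/funext => u; rewrite (dual_linear u).2.
  exact: cvgMl_tmp (fE v).
have f_sub (x : H) (e : R) v : 0 < e -> (\forall u \near F, rnorm (x - u) < e) ->
    (f v - x v) ^+ 2 <= e ^+ 2 * t v v.
  move=> e0 xF; have := near_f x e v xF.
  rewrite -ler_sqr ?nnegrE ?mulr_ge0 ?sqrtr_ge0 ?(ltW e0)//.
  by rewrite real_normK ?num_real// exprMn (sqr_sqrtr (form_ge0 t v)).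
have [x1 x1F] := Fc 1 ltr01.
have [M M0 x1M] := dual_bounded x1.
have fH : f \in dual_pred t.
  apply/asboolP; split=> //; exists (2 * (1 + M)) => v.
  have := f_sub x1 1 v ltr01 x1F; have := x1M v.
  by have := sqr_ge0 (f v - 2 * x1 v); lra.
apply/cvg_ex; exists (Dual fH); apply/cvg_rnormP => e e0.
have e2 : 0 < e / 2 by rewrite divr_gt0.
have [x xF] := Fc _ e2; apply: filterS (xF) => u xu.
have fx : rnorm (Dual fH - x) <= e / 2.
  by apply: dual_rnorm_le => [|v]; [exact: ltW | exact: f_sub].
have -> : Dual fH - u = (Dual fH - x) + (x - u) by rewrite addrA subrK.
by apply: le_lt_trans (rnormD _ _) _; rewrite [ltRHS]splitr; exact: ler_ltD.
Qed.

HB.instance Definition _ := Uniform_isComplete.Build H dual_complete.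

(** The imaginary part of a complex inner product is the real part at [- i u]. *)
Definition dual_inner (u g : H) : R[i] :=
  (dual_form t u g +i* dual_form t (- 'i%C *: u) g)%C.

Lemma dual_innerBl g : zmod_morphism (dual_inner ^~ g).
Proof.
by move=> u x; rewrite /dual_inner scalerBr !formDl !formNl.
Qed.

Lemma dual_innerC u g : dual_inner u g = Num.conj (dual_inner g u).
Proof.
rewrite /dual_inner (formC _ u g) formZ conj_Ni formC.
rewrite scaleNr formNl (formC _ u ('i%C *: g)); apply/eqP.
by rewrite eq_complex /= opprK !eqxx.
Qed.

Lemma dual_innerBr u : zmod_morphism (dual_inner u).
Proof.
by move=> g x; rewrite dual_innerC (dual_innerBl u g x) rmorphB /= -!dual_innerC.
Qed.

Lemma dual_innerZl g : scalable_for *%R (dual_inner ^~ g).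
Proof.
move=> z u.
have zE : z *: u = complex.Re z *r: u + complex.Im z *r: ('i%C *: u).
  by rewrite scalerA -scalerDl; congr (_ *: _); rewrite mulrC -complexE.
have izE : 'i%C *: (z *: u) = complex.Re z *r: ('i%C *: u) - complex.Im z *r: u.
  rewrite zE scalerDr !scalerA ['i%C * _]mulrC -mulrA.
  by rewrite ['i%C * _]mulrC -mulrA mulii mulrN1 scaleNr.
have E (x : H) : dual_form t (- 'i%C *: x) g = - dual_form t ('i%C *: x) g.
  by rewrite scaleNr formNl.
rewrite /dual_inner !E izE zE !formDl formNl !formZr; apply/eqP.
by case: z {zE izE} => a b; rewrite eq_complex /=; apply/andP; split; apply/eqP; lra.
Qed.

Lemma dual_innerZr u : scalable_for (Num.conj \; *%R) (dual_inner u).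
Proof.
by move=> z g; rewrite dual_innerC (dual_innerZl u z g) rmorphM /= -dual_innerC.
Qed.

HB.instance Definition _ := isBilinear.Build R[i] H H R[i] *%R (Num.conj \; *%R)
  dual_inner dual_innerBl dual_innerBr dual_innerZl dual_innerZr.

Lemma dual_inner_herm u g : dual_inner u g = (-1) ^+ false * Num.conj (dual_inner g u).
Proof. by rewrite expr0 mul1r dual_innerC. Qed.

HB.instance Definition _ := isHermitianSesquilinear.Build R[i] H false Num.conj
  dual_inner dual_inner_herm.

Lemma dual_inner_norm u : dual_inner u u = `|u| ^+ 2.
Proof.
rewrite -rnormE -rmorphXn /=.
have -> : rnorm u ^+ 2 = dual_form t u u by exact: dual_rnorm_sq.
have h : dual_form t (- 'i%C *: u) u = 0.
  have := formZ (dual_form t) (- 'i%C) u u; rewrite conj_Ni scaleNr formNl formC; lra.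
by rewrite /dual_inner h.
Qed.

Lemma dual_inner_gt0 u : u != 0 -> 0 < dual_inner u u.
Proof. by move=> u0; rewrite dual_inner_norm exprn_gt0// normr_gt0. Qed.

HB.instance Definition _ := isDotProduct.Build R[i] H dual_inner dual_inner_gt0.

Definition dual_hilbert : hilbertSpace R :=
  @HilbertSpace R H (dual_inner : {dot H for Num.conj}) dual_inner_norm.

End DualHilbert.

(** * Representations and reflections on the Hilbert space of functionals *)

Definition mk_operator (R : realType) (H : hilbertSpace R) (T : H -> H)
    (Tlin : linear T) (Tbd : exists M : R, forall x, rnorm (T x) <= M * rnorm x) :
    bounded_operator H :=
  let L : {linear H -> H} := HB.pack T (GRing.isLinear.Build R[i] H H *:%R T Tlin) in
  @BoundedOperator R H L Tbd.

Section Representation.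
Variables (R : realType) (A : cstarAlgebra R) (V : lmodType R[i]) (t : semiInner V).
Variable act : A -> V -> V.
Hypothesis actDl : forall a b v, act (a + b) v = act a v + act b v.
Hypothesis actZl : forall (z : R[i]) a v, act (z *: a) v = z *: act a v.
Hypothesis actDr : forall a v w, act a (v + w) = act a v + act a w.
Hypothesis actZr : forall (z : R[i]) a v, act a (z *: v) = z *: act a v.
Hypothesis actM : forall a b v, act (amul a b) v = act a (act b v).
Hypothesis act_adj : forall a v w, t (act a v) w = t v (act (astar a) w).
Hypothesis act_le : forall a v, t (act a v) (act a v) <= rnorm a ^+ 2 * t v v.
Local Notation H := (dual_hilbert t).
Implicit Types (a b : A) (f g u : dual t) (v w : V).

Lemma act_dual_subproof a f : (fun v => f (act (astar a) v)) \in dual_pred t.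
Proof.
have fl := dual_linear f; have [M M0 fM] := dual_bounded f.
apply/asboolP; split.
  by split=> [v w|r v]; rewrite ?actDr ?actZr ?fl.1 ?fl.2.
exists (M * rnorm (astar a) ^+ 2) => v.
by apply: le_trans (fM _) _; rewrite -mulrA ler_wpM2l.
Qed.

Definition act_dual a f : dual t := Dual (act_dual_subproof a f).

Lemma act_dual_linear a : linear (act_dual a).
Proof.
move=> z f g; apply: dualP => v.
by rewrite -[RHS]/(f (act (astar a) (Num.conj z *: v)) + g (act (astar a) v)) actZr.
Qed.

Lemma act_dual_le a f : rnorm (act_dual a f) <= rnorm (astar a) * rnorm f.
Proof.
apply: dual_rnorm_le; first by rewrite mulr_ge0 ?rnorm_ge0.
move=> v; apply: le_trans (dual_eval_le f (act (astar a) v)) _.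
by rewrite exprMn [leLHS]mulrC [leRHS]mulrAC ler_wpM2r ?sqr_ge0.
Qed.

Definition act_op a : bounded_operator H :=
  @mk_operator R H (act_dual a) (act_dual_linear a) (ex_intro _ _ (act_dual_le a)).

(** Maps adjoint for the real inner product are adjoint for the complex one. *)
Lemma inner_adjoint (S T : H -> H) : linear S ->
  (forall f g, dual_form t (S f) g = dual_form t f (T g)) ->
  forall f g : H, inner H (S f) g = inner H f (T g).
Proof.
move=> Slin adj f g; rewrite /= /dual_inner -!adj.
have SZ z h : S (z *: h) = z *: S h.
  have S0 : S 0 = 0.
    have := Slin 1 0 0; rewrite !scale1r addr0 => /esym/eqP.
    by rewrite -subr_eq0 addrK => /eqP.
  by have := Slin z h 0; rewrite !addr0 S0 addr0.
by rewrite -SZ.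
Qed.

Lemma act_dual_adj a f g :
  dual_form t (act_dual a f) g = dual_form t f (act_dual (astar a) g).
Proof.
apply: (@pairing_adjoint _ _ _ _ _ _ _ (act (astar a)) (act a) (rnorm a ^+ 2)) => //.
- by move=> v w; rewrite act_adj astarK.
- by move=> v; rewrite /= astarK.
Qed.

Lemma act_op_adj a : is_adjoint (act_op a) (act_op (astar a)).
Proof. exact: inner_adjoint (act_dual_linear a) (act_dual_adj a). Qed.

Lemma act_opD a b (x : H) : act_op (a + b) x = act_op a x + act_op b x.
Proof. by apply: dualP => v /=; rewrite astarD actDl (dual_linear x).1. Qed.

Lemma act_opZ (z : R[i]) a (x : H) : act_op (z *: a) x = z *: act_op a x.
Proof. by apply: dualP => v /=; rewrite astarZ actZl actZr. Qed.

Lemma act_opM a b (x : H) : act_op (amul a b) x = act_op a (act_op b x).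
Proof. by apply: dualP => v /=; rewrite astarM actM. Qed.

Definition dual_rep : star_representation A H :=
  StarRepresentation act_opD act_opZ act_opM act_op_adj.

Lemma act_dual_riesz a v : act_dual a (riesz t v) = riesz t (act a v).
Proof. by apply: dualP => w /=; rewrite act_adj. Qed.

Lemma riesz_dense f (e : R) : 0 < e -> exists v, rnorm (f - riesz t v) <= e.
Proof.
move=> e0.
have [v [_ vf]] := approximates_exists (I : [set: V] 0) (@setT_closedD _ V)
  (@setT_closedZ _ V) f (exprn_gt0 2 e0).
exists v; apply: dual_rnorm_le; first exact: ltW.
by move=> w; exact: vf.
Qed.

Lemma riesz_rnorm v (e : R) : 0 <= e -> t v v <= e ^+ 2 -> rnorm (riesz t v) <= e.
Proof.
move=> e0 ve; apply: dual_rnorm_le => // w; apply: le_trans (form_cauchy_schwarz _ _ _) _.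
by rewrite ler_wpM2r ?form_ge0.
Qed.

(** Every vector is close to some [riesz t v], and [riesz t (act a v)] is the image of
    [riesz t v] under [a]. *)
Lemma dual_rep_nondegenerate :
  (forall v (e : R), 0 < e -> exists a, t (v - act a v) (v - act a v) <= e ^+ 2) ->
  nondegenerate_rep dual_rep.
Proof.
move=> approx O [f Of] Oopen.
have : nbhs f O by exact: open_nbhs_nbhs.
move/nbhs_ballP => [e e0 eO]; have [r r0 er] := gt0_real e0.
have r3 : 0 < r / 3 by rewrite divr_gt0.
have [v fv] := riesz_dense f r3.
have [a av] := approx v _ r3.
exists (riesz t (act a v)); split.
  apply: eO; rewrite -ball_normE /= er -rnorm_ltE.
  have -> : f - riesz t (act a v) = (f - riesz t v) + riesz t (v - act a v).
    by rewrite rieszD -scaleN1r rieszZ scaleN1r addrA subrK.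
  apply: le_lt_trans (rnormD _ _) _.
  by have := riesz_rnorm (ltW r3) av; lra.
exists [:: (1, riesz t (act a v))]; split; last by rewrite big_seq1 /= scale1r.
by move=> p; rewrite inE => /eqP -> /=; exists a, (riesz t v); rewrite -act_dual_riesz.
Qed.

End Representation.

Section Projection.
Variables (R : realType) (V : lmodType R[i]) (t : semiInner V) (W : set V).
Hypothesis W0 : W 0.
Hypothesis WD : forall v w, W v -> W w -> W (v + w).
Hypothesis WZ : forall (z : R[i]) v, W v -> W (z *: v).
Local Notation H := (dual_hilbert t).
Local Notation pair := (@pairing_form R V t W W0 WD WZ).
Implicit Types (f g u : dual t) (v w : V).

(** The orthogonal projection of [f] onto the closure of the image of [W] has the same
    inner products with [W] as [f].  It is therefore the functional that sends [v] to the
    inner product of the restrictions of [f] and [riesz t v] to [W]. *)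
Lemma proj_eval_le f v : pair f (riesz t v) ^+ 2 <= rnorm f ^+ 2 * t v v.
Proof.
apply: le_trans (form_cauchy_schwarz _ _ _) _; apply: ler_pM; rewrite ?form_ge0//.
  by apply: (pairing_le W0 WD WZ) => [|w _]; [exact: sqr_ge0 | exact: dual_eval_le].
apply: (pairing_le W0 WD WZ) => [|w _]; first exact: form_ge0.
exact: form_cauchy_schwarz.
Qed.

Lemma proj_subproof f : (fun v => pair f (riesz t v)) \in dual_pred t.
Proof.
apply/asboolP; split; last by exists (rnorm f ^+ 2) => v; exact: proj_eval_le.
by split=> [v w|r v]; rewrite ?rieszD ?rieszZ ?formDr ?formZrr.
Qed.

Definition proj f : dual t := Dual (proj_subproof f).

Lemma projE f v : proj f v = pair f (riesz t v). Proof. by []. Qed.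

Lemma proj_linear : linear proj.
Proof.
move=> z f g; apply: dualP => v; rewrite projE formDl formZ -rieszZ.
by [].
Qed.

(** Both sides are continuous in [g], and they agree by definition when [g] is
    [riesz t w]. *)
Lemma dual_form_proj f g : dual_form t (proj f) g = pair f g.
Proof.
apply: (pairingE (I : [set: V] 0) (@setT_closedD _ V) (@setT_closedZ _ V)).
exists (pair f f) => w e e0 [_ gw].
have -> : proj f w - pair f g = pair f (riesz t w - g).
  by rewrite projE formDr (formC _ f (- g)) formNl (formC _ g f).
apply: le_trans (form_cauchy_schwarz _ _ _) _.
rewrite ler_wpM2l ?form_ge0//; apply: (pairing_le W0 WD WZ) => [|v _]; first exact: ltW.
by rewrite dualDE dualNE -sqrrN opprB; exact: (gw v I).
Qed.

Lemma proj_adj f g : dual_form t (proj f) g = dual_form t f (proj g).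
Proof. by rewrite dual_form_proj [RHS]formC dual_form_proj; exact: formC. Qed.

Lemma proj_riesz w : W w -> proj (riesz t w) = riesz t w.
Proof.
move=> Ww; apply: dualP => v; rewrite projE formC.
by rewrite -[LHS]/(pairing W _ _) (pairing_riesz W0 WD WZ _ Ww); exact: formC.
Qed.

Lemma proj_evalW f w : W w -> proj f w = f w.
Proof. by move=> Ww; exact: (pairing_riesz W0 WD WZ). Qed.

Lemma proj_ext f g : (forall w, W w -> f w = g w) -> proj f = proj g.
Proof.
move=> fg; apply/eqP; rewrite -subr_eq0; apply/eqP; apply: dualP => v.
have -> : (proj f - proj g) v = pair (f - g) (riesz t v).
  by rewrite formDl formNl.
have p0 : pair (f - g) (f - g) <= 0.
  apply: (pairing_le W0 WD WZ) => // w Ww.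
  by rewrite dualDE dualNE fg// subrr expr0n mul0r.
apply/eqP; rewrite -sqrf_eq0 eq_le sqr_ge0 andbT.
apply: le_trans (form_cauchy_schwarz _ _ _) _.
by rewrite mulr_le0_ge0 ?form_ge0.
Qed.

Lemma proj0 f : (forall w, W w -> f w = 0) -> proj f = 0.
Proof.
move=> f0; rewrite (proj_ext (g := 0)) => [|w Ww]; last by rewrite f0.
by apply: dualP => v; rewrite projE form0l.
Qed.

(** The projection commutes with operators that, like their adjoints, preserve [W]. *)
Lemma proj_comm (S S' : V -> V) (K : R) (f g : dual t) :
  (forall w, W w -> W (S w)) -> (forall v, W v -> W (S' v)) ->
  (forall v w, t (S v) w = t v (S' w)) ->
  (forall v, t (S' v) (S' v) <= K * t v v) ->
  (forall v, g v = f (S v)) -> forall v, proj g v = proj f (S v).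
Proof.
move=> WS WS' adj hK gE v; rewrite !projE.
by apply: (pairing_adjoint W0 WD WZ WS WS' adj hK gE) => w /=; rewrite adj.
Qed.

Definition refl f : dual t := 2 *r: proj f - f.

Lemma refl_linear : linear refl.
Proof.
move=> z f g; rewrite /refl proj_linear scalerDr opprD addrACA; congr (_ + _).
by rewrite scalerBr !scalerA [_ * z]mulrC.
Qed.

Lemma reflK f : refl (refl f) = f.
Proof.
rewrite {1}/refl; have -> : proj (refl f) = proj f.
  apply: proj_ext => w Ww; rewrite /refl dualDE dualNE dualZrE proj_evalW//; lra.
by rewrite /refl opprB addrC subrK.
Qed.

Lemma refl_adj f g : dual_form t (refl f) g = dual_form t f (refl g).
Proof.
rewrite /refl formDl formDr formNl formZr formZrr proj_adj formC.
by rewrite [in RHS](formC _ _ (- g)) formNl (formC _ g).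
Qed.

Lemma refl_le f : rnorm (refl f) <= 1 * rnorm f.
Proof.
rewrite mul1r -ler_sqr ?nnegrE ?rnorm_ge0// !dual_rnorm_sq.
by rewrite refl_adj reflK.
Qed.

Definition refl_op : bounded_operator H :=
  @mk_operator R H refl refl_linear (ex_intro _ 1 refl_le).

Lemma refl_op_hermitian : Defs.is_hermitian refl_op.
Proof. exact: (inner_adjoint refl_linear refl_adj). Qed.

Lemma refl_op_unitary : Defs.is_unitary refl_op.
Proof. exists refl_op; split; [exact: refl_op_hermitian | exact: reflK | exact: reflK]. Qed.

End Projection.

(** * The unitization of a C*-algebra *)

Section CStarNorm.
Variables (R : realType) (A : cstarAlgebra R).
Implicit Types (a b : A).

Lemma rnorm_amul a b : rnorm (amul a b) <= rnorm a * rnorm b.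
Proof. by have := norm_amul a b; rewrite -!rnormE -rmorphM lecR. Qed.

Lemma rnorm_astar_amul a : rnorm (amul (astar a) a) = rnorm a ^+ 2.
Proof. by have := norm_astar_amul a; rewrite -!rnormE -rmorphXn => /complexI. Qed.

Lemma rnorm_le_astar a : rnorm a <= rnorm (astar a).
Proof.
have := rnorm_amul (astar a) a; rewrite rnorm_astar_amul expr2.
have [->|a0] := eqVneq (rnorm a) 0; first by rewrite rnorm_ge0.
by rewrite ler_pM2r// lt_neqAle eq_sym a0 rnorm_ge0.
Qed.

Lemma rnorm_astar a : rnorm (astar a) = rnorm a.
Proof.
apply/eqP; rewrite eq_le rnorm_le_astar andbT.
by have := rnorm_le_astar (astar a); rewrite astarK.
Qed.

Lemma amulNl a b : amul (- a) b = - amul a b.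
Proof. by rewrite -scaleN1r amulZl scaleN1r. Qed.

Lemma amulNr a b : amul a (- b) = - amul a b.
Proof. by rewrite -scaleN1r amulZr scaleN1r. Qed.

Lemma astarN a : astar (- a) = - astar a.
Proof. by rewrite -scaleN1r astarZ rmorphN rmorph1 scaleN1r. Qed.

Lemma amul0l b : amul 0 b = 0 :> A.
Proof. by rewrite -[0](scale0r 0) amulZl !scale0r. Qed.

Lemma amul0r b : amul b 0 = 0 :> A.
Proof. by rewrite -[0](scale0r 0) amulZr !scale0r. Qed.

Lemma astar0 : astar 0 = 0 :> A.
Proof. by rewrite -[0](scale0r 0) astarZ rmorph0 !scale0r. Qed.

End CStarNorm.

(** [R[i]^o] is the field of scalars as a module over itself. *)
Definition unitization (R : realType) (A : cstarAlgebra R) : Type := (R[i]^o * A)%type.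

Section Unitization.
Variables (R : realType) (A : cstarAlgebra R).
Local Notation U := (unitization A).
Implicit Types (x y z : U) (a b : A).

HB.instance Definition _ := GRing.Lmodule.on U.

Definition uni_one : U := (1, 0).
Definition uni_mul x y : U := (x.1 * y.1, x.1 *: y.2 + y.1 *: x.2 + amul x.2 y.2).

Lemma uni_ext x y : x.1 = y.1 -> x.2 = y.2 -> x = y.
Proof. by case: x y => [a b] [c d] /= -> ->. Qed.

Lemma uni_mulA : associative uni_mul.
Proof.
move=> x y z; apply: uni_ext; rewrite /= ?mulrA//.
rewrite !(scalerDr, amulDl, amulDr, amulZl, amulZr, scalerA) amulA.
rewrite [z.1 * _]mulrC [z.1 * _]mulrC [y.1 * z.1]mulrC.
by rewrite !addrA [LHS](ACl (1*2*4*6*3*5*7)).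
Qed.

Lemma uni_mul1r : left_id uni_one uni_mul.
Proof.
by move=> x; apply: uni_ext; rewrite /= ?mul1r// scale1r scaler0 amul0l !addr0.
Qed.

Lemma uni_mulr1 : right_id uni_one uni_mul.
Proof.
by move=> x; apply: uni_ext; rewrite /= ?mulr1// scale1r scaler0 amul0r addr0 add0r.
Qed.

Lemma uni_mulDl : left_distributive uni_mul +%R.
Proof.
move=> x y z; apply: uni_ext; rewrite /= ?mulrDl// scalerDl scalerDr amulDl.
by rewrite !addrA [LHS](ACl (1*3*5*2*4*6)).
Qed.

Lemma uni_mulDr : right_distributive uni_mul +%R.
Proof.
move=> x y z; apply: uni_ext; rewrite /= ?mulrDr// scalerDl scalerDr amulDr.
by rewrite !addrA [LHS](ACl (1*3*5*2*4*6)).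
Qed.

Lemma uni_one_neq0 : uni_one != 0.
Proof. by apply/eqP => -[/eqP]; rewrite oner_eq0. Qed.

HB.instance Definition _ := GRing.Zmodule_isNzRing.Build U
  uni_mulA uni_mul1r uni_mulr1 uni_mulDl uni_mulDr uni_one_neq0.

Lemma uni_scaleAl (k : R[i]) x y : k *: (x * y) = (k *: x) * y.
Proof.
apply: uni_ext; first exact: mulrA.
by rewrite /= !scalerDr !scalerA amulZl [y.1 * k]mulrC.
Qed.

HB.instance Definition _ := GRing.Lmodule_isLalgebra.Build R[i] U uni_scaleAl.

Lemma uni_scaleAr (k : R[i]) x y : k *: (x * y) = x * (k *: y).
Proof.
apply: uni_ext; first exact: mulrCA.
by rewrite /= !scalerDr !scalerA amulZr [k * x.1]mulrC.
Qed.

HB.instance Definition _ := GRing.Lalgebra_isAlgebra.Build R[i] U uni_scaleAr.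

Definition uni_star x : U := (Num.conj x.1, astar x.2).

Lemma uni_starK x : uni_star (uni_star x) = x.
Proof. by apply: uni_ext; rewrite /= ?conjCK ?astarK. Qed.

Lemma uni_starD x y : uni_star (x + y) = uni_star x + uni_star y.
Proof. by apply: uni_ext; rewrite /= ?rmorphD ?astarD. Qed.

Lemma uni_starZ (k : R[i]) x : uni_star (k *: x) = Num.conj k *: uni_star x.
Proof. by apply: uni_ext; rewrite /= ?rmorphM ?astarZ. Qed.

Lemma uni_starM x y : uni_star (x * y) = uni_star y * uni_star x.
Proof.
apply: uni_ext; first by rewrite /= rmorphM mulrC.
by rewrite /= !astarD !astarZ astarM [in LHS](addrC (_ *: _)).
Qed.

(** The unitization acts on [A] by left multiplication, and gets the operator
    seminorm of this action. *)
Definition uni_act x a : A := x.1 *: a + amul x.2 a.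

Lemma uni_actZ x (k : R[i]) a : uni_act x (k *: a) = k *: uni_act x a.
Proof. by rewrite /uni_act scalerDr amulZr !scalerA mulrC. Qed.

Lemma uni_actD x y a : uni_act (x + y) a = uni_act x a + uni_act y a.
Proof. by rewrite /uni_act /= scalerDl amulDl addrACA. Qed.

Lemma uni_actZl (k : R[i]) x a : uni_act (k *: x) a = k *: uni_act x a.
Proof. by rewrite /uni_act /= scalerDr scalerA amulZl. Qed.

Lemma uni_actM x y a : uni_act (x * y) a = uni_act x (uni_act y a).
Proof.
rewrite /uni_act /= !amulDl !amulZl !amulDr amulZr !scalerDr scalerA amulA.
by rewrite !addrA.
Qed.

Lemma uni_act1 a : uni_act 1 a = a.
Proof. by rewrite /uni_act /= scale1r amul0l addr0. Qed.

Lemma uni_act_bounded x : exists M : R, forall a, rnorm (uni_act x a) <= M * rnorm a.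
Proof.
exists (complex.Re `|x.1| + rnorm x.2) => a; rewrite mulrDl.
by apply: le_trans (rnormD _ _) _; rewrite rnormZ lerD2l rnorm_amul.
Qed.

Lemma uni_act_adj x a b :
  amul (astar (uni_act x a)) b = amul (astar a) (uni_act (uni_star x) b).
Proof.
by rewrite /uni_act /= astarD astarZ astarM amulDl amulDr amulZl amulZr amulA.
Qed.

Definition uni_norm x : R := opsup (uni_act x).

Lemma uni_norm_bound x a : rnorm (uni_act x a) <= uni_norm x * rnorm a.
Proof. exact: (opsup_bound (uni_actZ x) (uni_act_bounded x)). Qed.

Lemma uni_norm_ge0 x : 0 <= uni_norm x.
Proof. exact: (opsup_ge0 (uni_act_bounded x)). Qed.

Lemma uni_norm_le x (M : R) : 0 <= M -> (forall a, rnorm (uni_act x a) <= M * rnorm a) ->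
  uni_norm x <= M.
Proof. exact: opsup_le. Qed.

Lemma uni_normD x y : uni_norm (x + y) <= uni_norm x + uni_norm y.
Proof.
apply: uni_norm_le => [|a]; first by rewrite addr_ge0 ?uni_norm_ge0.
rewrite uni_actD mulrDl; apply: le_trans (rnormD _ _) _.
by apply: lerD; exact: uni_norm_bound.
Qed.

Lemma uni_normZ_le (k : R[i]) x : uni_norm (k *: x) <= complex.Re `|k| * uni_norm x.
Proof.
apply: uni_norm_le => [|a]; first by rewrite mulr_ge0 ?uni_norm_ge0 ?Re_norm_ge0.
by rewrite uni_actZl rnormZ -mulrA ler_wpM2l ?Re_norm_ge0// uni_norm_bound.
Qed.

Lemma uni_normZ (k : R[i]) x : uni_norm (k *: x) = complex.Re `|k| * uni_norm x.
Proof. exact: (homogeneous_of_le uni_norm_ge0 uni_normZ_le). Qed.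

Lemma uni_normM x y : uni_norm (x * y) <= uni_norm x * uni_norm y.
Proof.
apply: uni_norm_le => [|a]; first by rewrite mulr_ge0 ?uni_norm_ge0.
rewrite uni_actM; apply: le_trans (uni_norm_bound _ _) _.
by rewrite -mulrA ler_wpM2l ?uni_norm_ge0 ?uni_norm_bound.
Qed.

Lemma uni_norm1 : uni_norm 1 <= 1.
Proof. by apply: uni_norm_le => // a; rewrite uni_act1 mul1r. Qed.

(** [|x a|^2 = |a^* (x^* x a)|] is at most [|x^* x| |a|^2]. *)
Lemma uni_norm_sq_le x : uni_norm x ^+ 2 <= uni_norm (uni_star x * x).
Proof.
have n0 := uni_norm_ge0 (uni_star x * x).
suff : uni_norm x <= Num.sqrt (uni_norm (uni_star x * x)).
  by rewrite -ler_sqr ?nnegrE ?sqrtr_ge0 ?uni_norm_ge0// sqr_sqrtr.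
apply: uni_norm_le => [|a]; first exact: sqrtr_ge0.
rewrite -ler_sqr ?nnegrE ?mulr_ge0 ?sqrtr_ge0 ?rnorm_ge0// exprMn sqr_sqrtr//.
rewrite -rnorm_astar_amul uni_act_adj -uni_actM.
apply: le_trans (rnorm_amul _ _) _.
rewrite rnorm_astar [rnorm a ^+ 2]expr2 mulrA [leRHS]mulrC.
by rewrite ler_wpM2l ?rnorm_ge0// uni_norm_bound.
Qed.

Lemma uni_norm_le_star x : uni_norm x <= uni_norm (uni_star x).
Proof.
have := le_trans (uni_norm_sq_le x) (uni_normM _ _); rewrite expr2.
have [->|x0] := eqVneq (uni_norm x) 0; first by rewrite uni_norm_ge0.
by rewrite ler_pM2r// lt_neqAle eq_sym x0 uni_norm_ge0.
Qed.

Lemma uni_norm_star x : uni_norm (uni_star x * x) = uni_norm x ^+ 2.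
Proof.
apply/eqP; rewrite eq_le uni_norm_sq_le andbT expr2.
apply: le_trans (uni_normM _ _) _; rewrite ler_wpM2r ?uni_norm_ge0//.
by have := uni_norm_le_star (uni_star x); rewrite uni_starK.
Qed.

Definition uni_cstar : cstarSeminormed R :=
  @CStarSeminormed R U uni_star uni_norm uni_starK uni_starD uni_starZ uni_starM
    uni_normD uni_normZ uni_normM uni_norm1 uni_norm_star.

Definition emb a : uni_cstar := ((0, a) : U).

(** The lower bound is attained at [a^*], by the C*-identity. *)
Lemma emb_norm a : unorm (emb a) = rnorm a.
Proof.
apply/eqP; rewrite eq_le; apply/andP; split.
  apply: uni_norm_le => [|b]; first exact: rnorm_ge0.
  by rewrite /uni_act /= scale0r add0r rnorm_amul.
have [->|a0] := eqVneq (rnorm a) 0; first exact: uni_norm_ge0.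
have := uni_norm_bound (emb a) (astar a).
rewrite /uni_act /= scale0r add0r -[X in amul X _]astarK rnorm_astar_amul expr2.
by rewrite rnorm_astar ler_pM2r// lt_neqAle eq_sym a0 rnorm_ge0.
Qed.

Lemma embD a b : emb (a + b) = emb a + emb b.
Proof. by apply: uni_ext; rewrite /= ?addr0. Qed.

Lemma embZ (k : R[i]) a : emb (k *: a) = k *: emb a.
Proof. by apply: uni_ext; rewrite /= ?scaler0. Qed.

Lemma embM a b : emb (amul a b) = emb a * emb b.
Proof. by apply: uni_ext; rewrite /= ?mul0r// !scale0r !add0r. Qed.

Lemma emb_star a : emb (astar a) = ustar (emb a).
Proof. by apply: uni_ext; rewrite /= ?rmorph0. Qed.

End Unitization.

(** * Representations and commutator seminorms *)

Section ExactRoot.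
Variables (R : realType) (A : cstarAlgebra R) (x : A) (r : R).
Hypotheses (r0 : 0 <= r) (r1 : r < 1) (xr : rnorm x <= r) (xs : astar x = x).

(** A fixed point [y] of [step] satisfies [2 y - y^2 = x]. *)
Let step (y : A) : A := 2^-1 *r: (x + amul y y).
Let root_seq n := iter n step 0.

Lemma half_norm (V : normedModType R[i]) (v : V) (m : R) :
  rnorm v <= 2 * m -> rnorm (2^-1 *r: v) <= m.
Proof. by move=> vm; rewrite rnormZr ger0_norm ?invr_ge0// ler_pdivrMl. Qed.

Lemma root_seq_le n : rnorm (root_seq n) <= r.
Proof.
elim: n => [|n IH]; first by rewrite rnorm0.
apply: half_norm; apply: le_trans (rnormD _ _) _.
have h := le_trans (rnorm_amul _ _) (ler_pM (rnorm_ge0 _) (rnorm_ge0 _) IH IH).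
apply: le_trans (lerD xr h) _.
have : r * r <= r by rewrite ler_piMr// ltW.
lra.
Qed.

Lemma root_seq_star n : astar (root_seq n) = root_seq n.
Proof.
by elim: n => [|n IH]; rewrite ?astar0//= astarZ conj_real astarD astarM xs IH.
Qed.

Lemma step_contraction y z : rnorm y <= r -> rnorm z <= r ->
  rnorm (step y - step z) <= r * rnorm (y - z).
Proof.
move=> yr zr; rewrite /step -scalerBr; apply: half_norm.
have -> : x + amul y y - (x + amul z z) = amul (y - z) y + amul z (y - z).
  rewrite amulDl amulDr amulNl amulNr opprD addrACA subrr add0r.
  by rewrite addrA subrK.
apply: le_trans (rnormD _ _) _.
have h1 := le_trans (rnorm_amul (y - z) y) (ler_wpM2l (rnorm_ge0 _) yr).
have h2 := le_trans (rnorm_amul z (y - z)) (ler_wpM2r (rnorm_ge0 _) zr).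
lra.
Qed.

Lemma root_seq_dist n m : rnorm (root_seq (n + m) - root_seq n) <= r ^+ n.
Proof.
elim: n => [|n IH].
  by rewrite add0n subr0; apply: le_trans (root_seq_le _) _; rewrite ltW.
apply: le_trans (step_contraction (root_seq_le _) (root_seq_le _)) _.
by rewrite exprS ler_wpM2l.
Qed.

Lemma root_seq_lim : exists y, forall n, rnorm (y - root_seq n) <= r ^+ n.
Proof.
have c : cauchy (root_seq @ \oo).
  apply/cauchyP => _ /gt0_real[e e0 ->].
  have [n ne] := exists_expr_lt r0 r1 e0.
  exists (root_seq n); exists n => // m /= nm.
  rewrite -ball_normE /= -rnorm_ltE -rnormN opprB.
  by apply: le_lt_trans ne; rewrite -(subnKC nm); exact: root_seq_dist.
have /cvg_ex[y yl] : cvg (root_seq @ \oo) by exact/cauchy_cvgP.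
exists y => n; apply/ler_addgt0Pr => e e0.
have /cvg_rnormP/(_ e e0) [k _ kH] := yl.
have := kH (n + k)%N (leq_addl _ _) => /= h.
have -> : y - root_seq n = (y - root_seq (n + k)) + (root_seq (n + k) - root_seq n).
  by rewrite addrA subrK.
apply: le_trans (rnormD _ _) _; rewrite addrC.
by apply: lerD; [exact: root_seq_dist | exact: ltW].
Qed.

(** The equation says that [1 - y] is a square root of [1 - x].  It has to be exact, because
    the continuity of representations, not known yet, will be deduced from it. *)
Lemma exists_exact_root : exists y, astar y = y /\ amul y y = y + y - x.
Proof.
have [y yn] := root_seq_lim.
have yr : rnorm y <= r.
  apply/ler_addgt0Pr => e e0; have [n ne] := exists_expr_lt r0 r1 e0.
  have := rnormD (y - root_seq n) (root_seq n); rewrite subrK.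
  by have := yn n; have := root_seq_le n; lra.
have zero_of (z : A) (K : R) : 0 <= K -> (forall n, rnorm z <= K * r ^+ n) -> z = 0.
  move=> K0 zn; apply: rnorm_eq0; apply/eqP; rewrite eq_le rnorm_ge0 andbT.
  apply/ler_addgt0Pr => e e0; rewrite add0r.
  have K1 : 0 < 1 + K by lra.
  have [n ne] := exists_expr_lt r0 r1 (divr_gt0 e0 K1).
  apply: le_trans (zn n) _; apply: le_trans (ler_wpM2l K0 (ltW ne)) _.
  by rewrite mulrCA ler_piMr ?(ltW e0)// ler_pdivrMr// mul1r; lra.
have ys : astar y = y.
  apply/eqP; rewrite -subr_eq0; apply/eqP; apply: (zero_of _ 2) => // n.
  have -> : astar y - y = astar (y - root_seq n) - (y - root_seq n).
    by rewrite astarD astarN root_seq_star opprB addrA subrK.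
  by apply: le_trans (rnormB _ _) _; rewrite rnorm_astar; have := yn n; lra.
have yE : step y = y.
  apply/eqP; rewrite -subr_eq0; apply/eqP; apply: (zero_of _ 2) => // n.
  have -> : step y - y = (step y - step (root_seq n)) - (y - root_seq n.+1).
    by rewrite opprB addrA subrK.
  apply: le_trans (rnormB _ _) _.
  have h1 := step_contraction yr (root_seq_le n).
  have h2 := yn n; have h3 := yn n.+1; rewrite exprS in h3.
  have rn := exprn_ge0 n r0.
  have := ler_wpM2l r0 h2; have : r * r ^+ n <= r ^+ n by rewrite ler_piMl// ltW.
  lra.
exists y; split=> //.
have : 2 *r: step y = x + amul y y by rewrite /step rscaleA mulfV// rscale1.
rewrite yE => h.
have -> : y + y = 2 *r: y by rewrite -[in LHS](rscale1 y) -rscaleDl.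
by rewrite h addrAC subrr add0r.
Qed.

End ExactRoot.

Section RepresentationNorm.
Variables (R : realType) (A : cstarAlgebra R) (H : hilbertSpace R).
Variable pi : star_representation A H.
Implicit Types (a b c : A) (x y : H).

Lemma piN a x : pi (- a) x = - pi a x.
Proof. by rewrite -scaleN1r repZ scaleN1r. Qed.

Lemma innerBl x y z : inner H (x - y) z = inner H x z - inner H y z.
Proof. exact: linearBl. Qed.

Lemma innerDr x y z : inner H z (x + y) = inner H z x + inner H z y.
Proof. exact: linearDr. Qed.

Lemma innerBr x y z : inner H z (x - y) = inner H z x - inner H z y.
Proof. exact: linearBr. Qed.

Lemma rnorm_le_inner x y : inner H x x <= inner H y y -> rnorm x <= rnorm y.
Proof.
by rewrite !inner_norm -!rnormE -!rmorphXn lecR ler_sqr ?nnegrE ?rnorm_ge0.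
Qed.

(** If [a^* a = 2 y - y^2] with [y] selfadjoint then [|x|^2 - |pi a x|^2 = |x - pi y x|^2]. *)
Lemma rep_le_lt1 a x : rnorm a < 1 -> rnorm (pi a x) <= rnorm x.
Proof.
move=> a1.
have n1 : rnorm (amul (astar a) a) <= rnorm a.
  by rewrite rnorm_astar_amul expr2 ler_piMl ?rnorm_ge0// ltW.
have s1 : astar (amul (astar a) a) = amul (astar a) a by rewrite astarM astarK.
have [y [ys yE]] := exists_exact_root (rnorm_ge0 a) a1 n1 s1.
apply: rnorm_le_inner; rewrite -subr_ge0.
have E1 : inner H (pi a x) (pi a x) = inner H x (pi (amul (astar a) a) x).
  by rewrite (rep_star pi a) -repM.
have E2 : inner H (pi y x) (pi y x) = inner H x (pi (amul y y) x).
  by rewrite (rep_star pi y) -repM ys.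
have E3 : inner H (pi y x) x = inner H x (pi y x) by rewrite (rep_star pi y) ys.
have -> : inner H x x - inner H (pi a x) (pi a x) = inner H (x - pi y x) (x - pi y x).
  rewrite innerBl !innerBr E1 E2 E3 yE (repD pi (y + y)) repD piN.
  rewrite innerBr !innerDr; ring.
by rewrite inner_norm exprn_ge0 ?normr_ge0.
Qed.

Lemma rep_le a x : rnorm (pi a x) <= rnorm a * rnorm x.
Proof.
suff h e : 0 < e -> rnorm (pi a x) <= (rnorm a + e) * rnorm x.
  apply/ler_addgt0Pr => e e0.
  have x1 : 0 < 1 + rnorm x by rewrite ltr_pwDl ?rnorm_ge0.
  apply: le_trans (h _ (divr_gt0 e0 x1)) _; rewrite mulrDl lerD2l.
  by rewrite mulrAC ler_pdivrMr// ler_wpM2l ?(ltW e0)//; lra.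
move=> e0; have c0 : 0 < rnorm a + e by rewrite ltr_wpDl ?rnorm_ge0.
have := @rep_le_lt1 ((rnorm a + e)^-1 *r: a) x.
rewrite repZ !rnormZr ger0_norm ?invr_ge0 ?(ltW c0)//.
by rewrite !ltr_pdivrMl// !ler_pdivrMl// mulr1 ltrDl => /(_ e0).
Qed.

Lemma unitary_norm (U : bounded_operator H) x : Defs.is_unitary U -> rnorm (U x) = rnorm x.
Proof.
move=> [V [adj VU _]]; apply/eqP; rewrite eq_le.
by apply/andP; split; apply: rnorm_le_inner; rewrite adj VU.
Qed.

Lemma opnorm_bound (T : bounded_operator H) x : rnorm (T x) <= opnorm T * rnorm x.
Proof. exact: (opsup_bound (linearZ_LR T) (op_bounded T)). Qed.

Lemma opnorm_ge0 (T : bounded_operator H) : 0 <= opnorm T.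
Proof. exact: (opsup_ge0 (op_bounded T)). Qed.

Lemma opnorm_le (T : bounded_operator H) (M : R) : 0 <= M ->
  (forall x, rnorm (T x) <= M * rnorm x) -> opnorm T <= M.
Proof. exact: opsup_le. Qed.

End RepresentationNorm.

Section CommutatorSeminorm.
Variables (R : realType) (A : cstarAlgebra R) (B : set A) (H : hilbertSpace R).
Variables (pi : star_representation A H) (U : bounded_operator H).
Hypothesis adm : admissible B pi U.
Implicit Types (a b c : A) (x y : H).
Local Notation K c := (commutator U (pi c)).

Let Un x : rnorm (U x) = rnorm x.
Proof. by apply: unitary_norm; case: adm. Qed.

Lemma commutator_opE c x : K c x = U (pi c x) - pi c (U x). Proof. by []. Qed.

Lemma commutator_seminorm_seminorm : is_seminorm (commutator_seminorm pi U).
Proof.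
have ge0 c : 0 <= commutator_seminorm pi U c.
  by rewrite mulr_ge0 ?invr_ge0 ?opnorm_ge0.
split=> // [a b|]; last first.
  apply: homogeneous_of_le => // z c.
  rewrite /commutator_seminorm mulrCA ler_wpM2l ?invr_ge0//.
  apply: opnorm_le => [|x]; first by rewrite mulr_ge0 ?Re_norm_ge0 ?opnorm_ge0.
  rewrite commutator_opE !repZ linearZ -scalerBr -commutator_opE rnormZ -mulrA.
  by rewrite ler_wpM2l ?Re_norm_ge0// opnorm_bound.
rewrite -mulrDr ler_wpM2l ?invr_ge0//.
apply: opnorm_le => [|x]; first by rewrite addr_ge0 ?opnorm_ge0.
rewrite commutator_opE !repD linearD opprD addrACA -!commutator_opE mulrDl.
by apply: le_trans (rnormD _ _) _; apply: lerD; exact: opnorm_bound.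
Qed.

(** The commutator with [U] is a derivation, and representations are contractive. *)
Lemma commutator_seminorm_leibniz : leibniz (commutator_seminorm pi U).
Proof.
split=> [|a c]; first exact: commutator_seminorm_seminorm.
rewrite /commutator_seminorm [rnorm a * _]mulrCA -mulrA -mulrDr ler_wpM2l ?invr_ge0//.
apply: opnorm_le => [|x].
  by rewrite addr_ge0 ?mulr_ge0 ?opnorm_ge0 ?rnorm_ge0.
have -> : K (amul a c) x = K a (pi c x) + pi a (K c x).
  by rewrite !commutator_opE !repM linearB addrA subrK.
apply: le_trans (rnormD _ _) _; rewrite mulrDl; apply: lerD.
  apply: le_trans (opnorm_bound _ _) _; rewrite -mulrA ler_wpM2l ?opnorm_ge0//.
  exact: rep_le.
apply: le_trans (rep_le _ _ _) _; rewrite -mulrA ler_wpM2l ?rnorm_ge0//.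
exact: opnorm_bound.
Qed.

(** Since [U] commutes with [pi b], the commutator does not change when [c] becomes
    [c - b]. *)
Lemma commutator_seminorm_le_dist c : B !=set0 ->
  commutator_seminorm pi U c <= dist_to B c.
Proof.
move=> [b0 Bb0]; apply: lb_le_inf; first by exists (rnorm (c - b0)); exists b0.
move=> _ [b Bb <-]; rewrite ler_pdivrMl//.
apply: opnorm_le => [|x]; first by rewrite mulr_ge0 ?rnorm_ge0.
have -> : K c x = K (c - b) x.
  have [_ _ _ /(_ b Bb x)] := adm.
  rewrite !commutator_opE !repD !piN => /eqP; rewrite subr_eq0 => /eqP h.
  by rewrite linearB h opprB addrA subrK.
rewrite commutator_opE; apply: le_trans (rnormB _ _) _; rewrite Un.
by have := rep_le pi (c - b) x; have := rep_le pi (c - b) (U x); rewrite Un; lra.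
Qed.

(** [U] commutes with the projection [pi one], which gives
    [[U, pi a'] = - pi a' [U, pi a] pi a']. *)
Lemma commutator_seminorm_inv one a a' : is_unit one -> B one ->
  amul a a' = one -> amul a' a = one ->
  commutator_seminorm pi U a' <= rnorm a' ^+ 2 * commutator_seminorm pi U a.
Proof.
move=> one1 Bone aa' a'a; rewrite mulrCA ler_wpM2l ?invr_ge0//.
apply: opnorm_le => [|x]; first by rewrite mulr_ge0 ?sqr_ge0 ?opnorm_ge0.
have eU y : U (pi one y) = pi one (U y).
  have [_ _ _ /(_ one Bone y)] := adm.
  by rewrite commutator_opE => /eqP; rewrite subr_eq0 => /eqP.
have e1 : U (pi a' x) = pi a' (pi a (U (pi a' x))).
  rewrite -[LHS]/(U (op (pi a') x)) -{1}(one1 a').1 repM eU -a'a repM.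
  by [].
have e2 : pi a' (U x) = pi a' (U (pi a (pi a' x))).
  by rewrite -repM aa' eU -repM (one1 a').2.
have -> : K a' x = - pi a' (K a (pi a' x)).
  by rewrite !commutator_opE linearB opprB -e2 -e1.
rewrite rnormN; apply: le_trans (rep_le _ _ _) _.
rewrite expr2 -!mulrA ler_wpM2l ?rnorm_ge0//.
apply: le_trans (opnorm_bound _ _) _.
by rewrite mulrCA ler_wpM2l ?opnorm_ge0// rep_le.
Qed.

End CommutatorSeminorm.

(** * The distance to a subalgebra *)

Section Pullback.
Variables (R : realType) (V V' : lmodType R[i]) (t : semiInner V') (i : {linear V -> V'}).

Definition pullback : semiInner V.
Proof.
refine (@SemiInner R V (fun v w => t (i v) (i w)) _ _ _ _ _).
- by move=> v v' w; rewrite linearD formDl.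
- by move=> r v w; rewrite linearZ formZr.
- by move=> z v w; rewrite !linearZ formZ.
- by move=> v w; rewrite formC.
- by move=> v; exact: form_ge0.
Defined.

Lemma pullback_functional_subproof (z : V') : (fun v => t z (i v)) \in dual_pred pullback.
Proof.
apply/asboolP; split; last by exists (t z z) => v; exact: form_cauchy_schwarz.
by split=> [v w|r v]; rewrite ?linearD ?linearZ ?formDr ?formZrr.
Qed.

Definition pullback_functional (z : V') : dual pullback :=
  Dual (pullback_functional_subproof z).

Lemma pullback_functional_le (z : V') : t z z <= 1 -> rnorm (pullback_functional z) <= 1.
Proof.
move=> z1; apply: dual_rnorm_le => // v; apply: le_trans (form_cauchy_schwarz _ _ _) _.
by rewrite expr1n ler_wpM2r ?form_ge0.
Qed.

End Pullback.

Section ApproximateIdentity.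
Variables (R : realType) (A : cstarAlgebra R) (B : set A).

Lemma tails_filter (I : Type) (le : rel I) : directed le -> Filter (tails le).
Proof.
move=> [[i0] le_refl le_trans le_dir]; apply: filter_from_filter; first by exists i0.
move=> i j _ _; have [k [ik jk]] := le_dir i j; exists k => // l /= kl.
by split; [exact: le_trans ik kl | exact: le_trans jk kl].
Qed.

Lemma approximate_identity_near : contains_bounded_approximate_identity B ->
  forall (a c : A) (e : R), 0 < e -> exists2 b, B b &
    rnorm (a - amul b a) < e /\ rnorm (c - amul b c) < e.
Proof.
move=> [I [le [E [dirI BE _ Ecvg]]]] a c e e0.
have FF := tails_filter dirI.
have /cvg_rnormP/(_ e e0) ha := (Ecvg a).1.
have /cvg_rnormP/(_ e e0) hc := (Ecvg c).1.
have [i _ iH] := filterI ha hc.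
have [_ le_refl _ _] := dirI.
by exists (E i) => //; exact: iH (le_refl i).
Qed.

End ApproximateIdentity.

Section DistanceAttained.
Variables (R : realType) (A : cstarAlgebra R) (B : set A).
Hypothesis hB : is_cstar_subalgebra B.
Hypothesis hid : contains_bounded_approximate_identity B.
Local Notation U := (uni_cstar A).
Implicit Types (a b c : A) (x y : U).

Let B0 : B 0 := subalg0 hB.

Definition dist_gauge x : R := inf [set unorm (x - emb b) | b in B].

Lemma dist_gauge_le x b : B b -> dist_gauge x <= unorm (x - emb b).
Proof.
move=> Bb; apply: ge_inf; last by exists b.
by exists 0 => _ [c _ <-]; exact: unorm_ge0.
Qed.

Lemma dist_gauge_ge x m : (forall b, B b -> m <= unorm (x - emb b)) -> m <= dist_gauge x.
Proof.
move=> h; apply: lb_le_inf; first by exists (unorm (x - emb 0)); exists 0.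
by move=> _ [b Bb <-]; exact: h.
Qed.

Lemma emb0 : emb 0 = 0 :> U. Proof. by []. Qed.

Lemma embN a : emb (- a) = - emb a.
Proof. by rewrite -scaleN1r embZ scaleN1r. Qed.

Lemma dist_gauge_sublinear : sublinear dist_gauge.
Proof.
apply: sublinear_intro.
- move=> x y; rewrite -lerBlDr; apply: dist_gauge_ge => b Bb.
  rewrite lerBlDr -lerBlDl; apply: dist_gauge_ge => c Bc; rewrite lerBlDl.
  apply: le_trans (dist_gauge_le _ (subalgD hB Bb Bc)) _.
  by rewrite embD opprD addrACA unormD.
- by apply: le_trans (dist_gauge_le _ B0) _; rewrite emb0 subr0 unorm0.
- move=> r x r0; rewrite -ler_pdivrMl//; apply: dist_gauge_ge => b Bb.
  rewrite ler_pdivrMl//; apply: le_trans (dist_gauge_le _ (subalgZ hB (r%:C)%C Bb)) _.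
  by rewrite embZ -scalerBr unormZp// ltW.
Qed.

Lemma dist_gauge_emb a : dist_gauge (emb a) = dist_to B a.
Proof.
rewrite /dist_gauge /dist_to; congr inf; apply/seteqP.
by split=> _ [b Bb <-]; exists b => //; rewrite -emb_norm embD embN.
Qed.

(** The Hahn-Banach theorem for the distance to [B] in the unitization. *)
Lemma exists_separating a : exists u : U -> R,
  [/\ real_linear u, forall x, u x <= unorm x, forall b, B b -> u (emb b) = 0
    & u (emb a) = dist_to B a].
Proof.
have [u [ulin ule ua]] := hahn_banach (emb a) dist_gauge_sublinear.
have ub b : B b -> u (emb b) <= 0.
  move=> Bb; apply: le_trans (ule _) (le_trans (dist_gauge_le _ Bb) _).
  by rewrite subrr unorm0.
exists u; split=> // [x|b Bb|]; last by rewrite ua dist_gauge_emb.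
  by apply: le_trans (ule x) (le_trans (dist_gauge_le _ B0) _); rewrite emb0 subr0.
apply/eqP; rewrite eq_le ub//=.
have := ub (- b); rewrite embN (real_linearN _ ulin) oppr_le0; apply.
by rewrite -scaleN1r; exact: subalgZ.
Qed.

Definition emb2 (v : A * A) : U * U := (emb v.1, emb v.2).

Lemma emb2_linear : linear emb2.
Proof. by move=> z v w; congr (_, _); rewrite /= embD embZ. Qed.

HB.instance Definition _ := GRing.isLinear.Build R[i] (A * A)%type (U * U)%type *:%R
  emb2 emb2_linear.

Definition act2 c (v : A * A) : A * A := (amul c v.1, amul c v.2).

Lemma emb2_act c v : emb2 (act2 c v) = lmul (emb c) (emb2 v).
Proof. by rewrite /emb2 /= !embM. Qed.

(** The representation acts on the completion of [A * A] for the form [gram u g1 g2].  The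
    vectors [e1] and [e2] are the functionals that [(1, 0)] and [(0, 1)] define on
    [A * A], and [P] projects onto the closure of the image of [B * 0]. *)
Lemma dist_attained a :
  exists (H : hilbertSpace R) (pi : star_representation A H) (T : bounded_operator H),
    admissible B pi T /\ dist_to B a = 2^-1 * opnorm (commutator T (pi a)).
Proof.
have [u [ulin uN uB ua]] := exists_separating a.
have [g1 [g2 [[g1lin g2lin] gN gS gu]]] := exists_dominating ulin uN.
have g1S x := (gS x).1; have g2S x := (gS x).2.
have g1N x := (gN x).1; have g2N x := (gN x).2.
pose G := gram_form ulin g1lin g2lin g1S g2S gu.
pose t : semiInner (A * A)%type := pullback G emb2.
have tE v w : t v w = gram u g1 g2 (emb2 v) (emb2 w) by [].
have act_adj c v w : t (act2 c v) w = t v (act2 (astar c) w).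
  by rewrite !tE !emb2_act emb_star gram_lmul.
have act_le c v : t (act2 c v) (act2 c v) <= rnorm c ^+ 2 * t v v.
  rewrite !tE !emb2_act -emb_norm.
  exact: (gram_lmul_le ulin uN g1lin g2lin g1S g2S g1N g2N gu).
have t_le v : t v v <= (rnorm v.1 + rnorm v.2) ^+ 2.
  have := gram_lmul_norm uN g1N g2N 1 (emb2 v).
  rewrite /lmul !mul1r -surjective_pairing -tE !emb_norm => h.
  apply: le_trans h _; rewrite ler_piMl ?sqr_ge0//; exact: unorm1.
have approx v (e : R) : 0 < e -> exists2 b, B b & t (v - act2 b v) (v - act2 b v) <= e ^+ 2.
  move=> e0; have e2 : 0 < e / 2 by rewrite divr_gt0.
  have [b Bb [h1 h2]] := approximate_identity_near hid v.1 v.2 e2.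
  exists b => //; apply: le_trans (t_le _) _.
  rewrite ler_sqr ?nnegrE ?addr_ge0 ?rnorm_ge0 ?(ltW e0)//=; lra.
have actDl b c v : act2 (b + c) v = act2 b v + act2 c v.
  by congr (_, _); rewrite /= amulDl.
have actZl (z : R[i]) b v : act2 (z *: b) v = z *: act2 b v.
  by congr (_, _); rewrite /= amulZl.
have actDr b v w : act2 b (v + w) = act2 b v + act2 b w.
  by congr (_, _); rewrite /= amulDr.
have actZr (z : R[i]) b v : act2 b (z *: v) = z *: act2 b v.
  by congr (_, _); rewrite /= amulZr.
have actM b c v : act2 (amul b c) v = act2 b (act2 c v).
  by congr (_, _); rewrite /= amulA.
pose pi := dual_rep actDl actZl actDr actZr actM act_adj act_le.
pose W : set (A * A) := [set v | B v.1 /\ v.2 = 0].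
have W0 : W 0 by [].
have WD v w : W v -> W w -> W (v + w).
  by move=> [Bv v2] [Bw w2]; split; [exact: subalgD | rewrite /= v2 w2 addr0].
have WZ (z : R[i]) v : W v -> W (z *: v).
  by move=> [Bv v2]; split; [exact: subalgZ | rewrite /= v2 scaler0].
have Wact b v : B b -> W v -> W (act2 b v).
  by move=> Bb [Bv v2]; split; [exact: subalgM | rewrite /= v2 amul0r].
pose T := refl_op t W0 WD WZ.
have proj_act b (f : dual t) : B b ->
    proj W0 WD WZ (pi b f) = pi b (proj W0 WD WZ f).
  move=> Bb; apply: dualP => v.
  apply: (proj_comm (S := act2 (astar b)) (S' := act2 b) W0 WD WZ (K := rnorm b ^+ 2)) => //.
  - by move=> w; apply: Wact; exact: subalg_star.
  - by move=> w; exact: Wact.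
  - by move=> w w'; rewrite act_adj astarK.
have adm : admissible B pi T.
  split.
  - apply: dual_rep_nondegenerate => v e e0.
    by have [b _ h] := approx v e e0; exists b.
  - exact: refl_op_hermitian.
  - exact: refl_op_unitary.
  - move=> b Bb x; rewrite commutator_opE; apply/eqP; rewrite subr_eq0; apply/eqP.
    rewrite -[LHS]/(2 *r: proj W0 WD WZ (pi b x) - pi b x) proj_act//.
    by rewrite -[RHS]/(pi b (2 *r: proj W0 WD WZ x - x)) linearB linearZ.
exists (dual_hilbert t), pi, T; split=> //.
apply/eqP; rewrite eq_le; apply/andP; split; last first.
  by apply: (commutator_seminorm_le_dist adm); exists 0.
(* The unit lies in the unitization, so that these functionals need not come from [A * A]. *)
pose e1 : dual t := pullback_functional G emb2 (1, 0).
pose e2 : dual t := pullback_functional G emb2 (0, 1).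
have e1_le : rnorm e1 <= 1.
  apply: pullback_functional_le; rewrite -[leLHS]/(gram u g1 g2 (1, 0) (1, 0)).
  by rewrite gram10//; apply: le_trans (g1N 1) _; exact: unorm1.
have e2_le : rnorm e2 <= 1.
  apply: pullback_functional_le; rewrite -[leLHS]/(gram u g1 g2 (0, 1) (0, 1)).
  by rewrite gram01//; apply: le_trans (g2N 1) _; exact: unorm1.
have pi_e1 c : pi c e1 = riesz t (c, 0).
  apply: dualP => v; rewrite -[LHS]/(gram u g1 g2 (1, 0) (emb2 (act2 (astar c) v))).
  rewrite emb2_act emb_star -gram_lmul -[RHS]/(gram u g1 g2 (emb2 (c, 0)) (emb2 v)).
  by rewrite /lmul /= mulr1 mulr0.
have e2W c : e2 (c, 0) = u (emb c).
  rewrite -[LHS]/(gram u g1 g2 (0, 1) (emb c, emb 0)) emb0.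
  exact: gram_cross.
pose P := proj (t := t) W0 WD WZ.
have Pe2 : P e2 = 0.
  by apply: proj0 => -[b c] [/= Bb ->]; exact: etrans (e2W b) (uB b Bb).
have Pe1 : P e1 = e1.
  apply/eqP; rewrite eq_sym -subr_eq0; apply/eqP; set f := e1 - _.
  (* [P] commutes with [pi b] and fixes [pi b e1], so that [f] vanishes on [B V],
     which is dense by the approximate identity. *)
  have fB b v : B b -> f (act2 b v) = 0.
    move=> Bb; have Bs : B (astar b) by exact: subalg_star.
    suff : pi (astar b) f = 0.
      by move/(congr1 (fun h : dual t => h v)); rewrite /= astarK.
    have -> : pi (astar b) f = pi (astar b) e1 - pi (astar b) (P e1) by exact: linearB.
    have := proj_act (astar b) e1 Bs; rewrite pi_e1 proj_riesz// => <-.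
    exact: subrr.
  apply: dualP => v; apply: (@sq_small_eq0 _ _ (rnorm f ^+ 2)) => e e0 e1'.
  have [b Bb h] := approx v _ e0.
  have -> : f v = f (v - act2 b v).
    by rewrite (dual_linear f).1 (real_linearN _ (dual_linear f)) fB// subr0.
  apply: le_trans (dual_eval_le _ _) _; rewrite ler_wpM2l ?sqr_ge0//.
  by apply: le_trans h _; rewrite expr2 ler_piMl// (ltW e0).
have key : dual_form t (commutator T (pi a) e1) e2 = - (2 * dist_to B a).
  have Te1 : T e1 = e1.
    by rewrite -[LHS]/(2 *r: P e1 - e1) Pe1 rscale2 addrK.
  have Te2 : refl W0 WD WZ e2 = - e2.
    by rewrite -[LHS]/(2 *r: P e2 - e2) Pe2 scaler0 sub0r.
  have -> : commutator T (pi a) e1 = T (pi a e1) - pi a e1 by rewrite commutator_opE Te1.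
  rewrite formDl formNl [dual_form t (T _) e2](refl_adj W0 WD WZ) Te2.
  rewrite formC formNl (formC _ e2) pi_e1 formC dual_form_riesz e2W ua; ring.
have h := dual_form_norm (commutator T (pi a) e1) e2.
rewrite key normrN in h; rewrite ler_pdivlMl//.
apply: le_trans (ler_norm _) (le_trans h _).
have h1 := opnorm_bound (commutator T (pi a)) e1.
apply: le_trans (ler_pM (rnorm_ge0 _) (rnorm_ge0 _) h1 e2_le) _.
by have := ler_wpM2l (opnorm_ge0 (commutator T (pi a))) e1_le; rewrite !mulr1.
Qed.

End DistanceAttained.

Theorem theorem3p2 (R : realType) (A : cstarAlgebra R) (B : set A)
    (hB : is_cstar_subalgebra B)
    (hid : contains_bounded_approximate_identity B) :
  [/\ forall a : A,
        exists (H : hilbertSpace R) (pi : star_representation A H)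
               (U : bounded_operator H),
          admissible B pi U /\
          dist_to B a = 2^-1 * opnorm (commutator U (pi a)),
      forall c : A,
        let S : set R :=
          [set r | exists (H : hilbertSpace R) (pi : star_representation A H)
                          (U : bounded_operator H),
                     admissible B pi U /\ r = commutator_seminorm pi U c] in
        has_sup S /\ dist_to B c = sup S,
      forall (H : hilbertSpace R) (pi : star_representation A H)
             (U : bounded_operator H),
        admissible B pi U -> leibniz (commutator_seminorm pi U),
      leibniz (dist_to B)
    & forall one : A, is_unit one -> B one ->
        strongly_leibniz one (dist_to B)].
Proof.
have attained := dist_attained hB hid.
have Bn0 : B !=set0 by exists 0; exact: subalg0.
have le_dist (H : hilbertSpace R) (pi : star_representation A H) U c :
    admissible B pi U -> commutator_seminorm pi U c <= dist_to B c.
  by move=> adm; exact: commutator_seminorm_le_dist.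
have dist_ge0 c : 0 <= dist_to B c.
  by have [H [pi [U [_ ->]]]] := attained c; rewrite mulr_ge0 ?invr_ge0 ?opnorm_ge0.
have dist_leibniz : leibniz (dist_to B).
  split; first split=> // [a b|].
  - have [H [pi [U [adm ->]]]] := attained (a + b).
    apply: le_trans (seminormD (commutator_seminorm_seminorm pi U) a b) _.
    by apply: lerD; exact: le_dist.
  - apply: homogeneous_of_le => // z a.
    have [H [pi [U [adm ->]]]] := attained (z *: a).
    rewrite -[leLHS]/(commutator_seminorm pi U (z *: a)).
    rewrite (seminormZ (commutator_seminorm_seminorm pi U)).
    by rewrite ler_wpM2l ?Re_norm_ge0// le_dist.
  - move=> a c; have [H [pi [U [adm ->]]]] := attained (amul a c).
    apply: le_trans ((commutator_seminorm_leibniz pi U).2 a c) _.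
    apply: lerD; first by rewrite ler_wpM2r ?rnorm_ge0// le_dist.
    by rewrite ler_wpM2l ?rnorm_ge0// le_dist.
split=> //.
- move=> c S.
  have [H [pi [U [adm E]]]] := attained c.
  have S_ub : ubound S (dist_to B c).
    by move=> _ [H' [pi' [U' [adm' ->]]]]; exact: le_dist.
  have S_c : S (dist_to B c) by exists H, pi, U.
  have hS : has_sup S by split; exists (dist_to B c).
  split=> //; apply/eqP; rewrite eq_le sup_upper_bound//.
  by apply: ge_sup => //; exists (dist_to B c).
- by move=> H pi U _; exact: commutator_seminorm_leibniz.
- move=> one one1 Bone; split=> //.
    apply/eqP; rewrite eq_le dist_ge0 andbT.
    apply: ge_inf; last by exists one => //; rewrite subrr rnorm0.
    by exists 0 => _ [b _ <-]; exact: rnorm_ge0.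
  move=> a a' aa' a'a; have [H [pi [U [adm ->]]]] := attained a'.
  apply: le_trans (commutator_seminorm_inv adm one1 Bone aa' a'a) _.
  by rewrite ler_wpM2l ?sqr_ge0// le_dist.
Qed.
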